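(* Let $X$ be a Hadamard space and $x\in X$. The cone topology on $\overline{\mathscr{W}_2(X)}=\mathscr{W}_2(X)\cup\partial\mathscr{W}_2(X)$ is well defined (that is, the open sets of $\mathscr{W}_2(X)$ together with the sets $U(x,\xi,R,\varepsilon)$, $\xi\in\partial\mathscr{W}_2(X)$, $R,\varepsilon>0$, form a basis of a topology) and is independent of the choice of the base point $\delta_x$, $x\in X$. Moreover, endowed with this topology, $\overline{\mathscr{W}_2(X)}$ is a first-countable Hausdorff space, and the topology it induces on $\mathscr{W}_2(X)$ coincides with the topology derived from the Wasserstein metric.
   Context: A geodesic in a metric space $Y$ is a curve $\gamma:I\to Y$ on an interval such that $d(\gamma_t,\gamma_{t'})=v|t-t'|$ for all $t,t'$ and some constant speed $v\ge 0$; unitary means $v=1$. A geodesic ray is a geodesic on $[0,+\infty)$. A Hadamard space is a complete separable, locally compact, geodesic, globally $\mathrm{CAT}(0)$ metric space. $\mathscr{W}_2(X)$ is the set of Borel probability measures on $X$ with finite second moment, with the quadratic Wasserstein metric $\mathrm{W}$. Two rays are asymptotic if they stay at bounded distance as $t\to+\infty$; $\partial\mathscr{W}_2(X)$ is the set of asymptote classes of unitary geodesic rays of $\mathscr{W}_2(X)$. For $x\in X$ and $\theta\in\overline{\mathscr{W}_2(X)}$, $\theta\neq\delta_x$, $\mu_{\delta_x,\theta}$ denotes the unique unitary geodesic of $\mathscr{W}_2(X)$ from the Dirac mass $\delta_x$ to $\theta$ (if $\theta\in\partial\mathscr{W}_2(X)$: the unique unitary ray starting at $\delta_x$ and belonging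 to the class $\theta$). For $\xi\in\partial\mathscr{W}_2(X)$ and $R,\varepsilon>0$, $$U(x,\xi,R,\varepsilon)=\{\theta\in\overline{\mathscr{W}_2(X)} : \theta\notin\overline{B}(\delta_x,R),\ \mathrm{W}((\mu_{\delta_x,\theta})_R,(\mu_{\delta_x,\xi})_R)<\varepsilon\},$$ where $\overline{B}(\delta_x,R)$ is the closed ball of $\mathscr{W}_2(X)$ (points of $\partial\mathscr{W}_2(X)$ are outside of it). The cone topology (with base point $\delta_x$) on $\overline{\mathscr{W}_2(X)}$ is defined by taking as a basis the open sets of $\mathscr{W}_2(X)$ together with all the sets $U(x,\xi,R,\varepsilon)$. *)

(* Defs.v *)
From HB Require Import structures.
From mathcomp Require Import all_boot all_order all_algebra.
From mathcomp Require Import all_classical all_reals all_analysis.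
From mathcomp Require Import measurable_realfun.

Set Implicit Arguments.
Unset Strict Implicit.
Unset Printing Implicit Defensive.

Import Order.TTheory GRing.Theory Num.Theory.

Local Open Scope classical_set_scope.
Local Open Scope ring_scope.

(* Pointedness is required by the library's measurable types; here it only
   says that the space is nonempty. *)
#[short(type="completePMetricType")]
HB.structure Definition CompletePointedMetric (R : numDomainType) :=
  {X of CompletePseudoMetric R X & Metric R X}.

Section Curves.
Context {R : realType} {Y : Type}.
Variable dist : Y -> Y -> R.
Implicit Types (I : interval R) (v : R) (gamma : R -> Y).

(* A curve on an interval [I] is given by a function on the whole of [R], whose
   values outside of [I] are irrelevant. *)
Definition geodesic_speed I v gamma : Prop :=
  {in I &, forall t t', dist (gamma t) (gamma t') = v * `|t - t'|}.

Definition geodesic I gamma : Prop :=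
  exists2 v, 0 <= v & geodesic_speed I v gamma.

Definition unit_geodesic I gamma : Prop := geodesic_speed I 1 gamma.

Definition unit_ray gamma : Prop := unit_geodesic `[0, +oo[ gamma.

Definition asymptotic gamma gamma' : Prop :=
  exists C : R, forall t, 0 <= t -> dist (gamma t) (gamma' t) <= C.

End Curves.

Section Hadamard.
Context {R : realType}.

Definition euclidean_dist (p q : 'rV[R]_2) : R :=
  Num.sqrt (\sum_i (p 0 i - q 0 i) ^+ 2).

Variable X : completePMetricType R.
Local Notation d := (@mdist R X).

Definition separable : Prop := exists2 D : set X, countable D & dense D.

Definition geodesic_space : Prop :=
  forall x y : X, exists gamma : R -> X,
    [/\ geodesic d `[0, 1] gamma, gamma 0 = x & gamma 1 = y].

(* Every geodesic triangle is thinner than its comparison triangle in the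
   Euclidean plane. Two given sides issue from a common vertex [p]; since [p],
   [q] and [r] are arbitrary, all pairs of sides are covered. *)
Definition CAT0 : Prop :=
  forall (p q r : X) (pq pr : R -> X),
    [/\ geodesic d `[0, 1] pq, pq 0 = p & pq 1 = q] ->
    [/\ geodesic d `[0, 1] pr, pr 0 = p & pr 1 = r] ->
  forall p' q' r' : 'rV[R]_2,
    [/\ euclidean_dist p' q' = d p q, euclidean_dist p' r' = d p r
      & euclidean_dist q' r' = d q r] ->
  forall s t : R, 0 <= s <= 1 -> 0 <= t <= 1 ->
    d (pq s) (pr t) <= euclidean_dist ((1 - s) *: p' + s *: q')
                                      ((1 - t) *: p' + t *: r').

(* Completeness is part of the type of [X]. *)
Definition hadamard : Prop :=
  [/\ separable, locally_compact [set: X], geodesic_space & CAT0].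

End Hadamard.

Section Wasserstein.
Context {R : realType}.
Variable X : completePMetricType R.
Local Notation d := (@mdist R X).

Local Notation borel := (g_sigma_algebraType (@open X)).

Definition finite_second_moment (mu : probability borel R) : Prop :=
  exists x0 : X, (\int[mu]_x (d x0 x ^+ 2)%:E < +oo)%E.

(* In the library a measure is a function on all the subsets of the space, and
   its values on the non-measurable ones are unconstrained. We set them to 0, so
   that two elements of [W2] are equal iff they agree on the Borel sets. *)
Record W2 := MkW2 {
  W2_prob :> probability borel R ;
  W2_moment : finite_second_moment W2_prob ;
  W2_nonmeasurable : forall A : set borel, ~ measurable A -> W2_prob A = 0%E }.

Definition coupling (mu nu : W2) : set (probability (borel * borel)%type R) :=
  [set pi | forall A : set borel, measurable A ->
    pi (A `*` setT) = mu A /\ pi (setT `*` A) = nu A].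

Definition W (mu nu : W2) : R :=
  Num.sqrt (fine (ereal_inf
    [set \int[pi]_z (d z.1 z.2 ^+ 2)%:E | pi in coupling mu nu]))%E.

Section Delta.
Variable x : X.

Definition borel_dirac (A : set borel) : \bar R :=
  if `[< measurable A >] then \d_(x : borel) A else 0%E.

Let borel_diracE (A : set borel) : measurable A -> borel_dirac A = \d_(x : borel) A.
Proof. by move=> mA; rewrite /borel_dirac asboolT. Qed.

Let borel_dirac0 : borel_dirac set0 = 0%E.
Proof. by rewrite borel_diracE ?measure0. Qed.

Let borel_dirac_ge0 A : (0 <= borel_dirac A)%E.
Proof. by rewrite /borel_dirac; case: ifP. Qed.

Let borel_dirac_sigma_additive : semi_sigma_additive borel_dirac.
Proof.
move=> F mF tF mUF; rewrite borel_diracE//.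
under eq_fun do under eq_bigr do rewrite borel_diracE//.
exact: measure_semi_sigma_additive.
Qed.

HB.instance Definition _ := isMeasure.Build _ _ _ borel_dirac
  borel_dirac0 borel_dirac_ge0 borel_dirac_sigma_additive.

Let borel_diracT : borel_dirac setT = 1%E.
Proof. by rewrite borel_diracE// diracT. Qed.

HB.instance Definition _ :=
  Measure_isProbability.Build _ _ _ borel_dirac borel_diracT.

Lemma borel_dirac_moment : finite_second_moment borel_dirac.
Proof.
exists x.
rewrite (eq_measure_integral (\d_(x : borel)))/=; last first.
  by move=> A mA _; exact: borel_diracE.
rewrite integral_dirac//=; first by rewrite diracT mul1e mdistxx ltry.
apply/measurable_EFinP; apply: measurable_funX.
apply: (measurability _ (RGenInftyO.measurableE R)).
move=> _ [_ [a ->] <-]; rewrite setTI; apply: sub_sigma_algebra.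
rewrite openE => y /=; rewrite in_itv/= => dxya.
apply/nbhs_ballP; exists (a - d x y); first by rewrite /= subr_gt0.
move=> z; rewrite ballEmdist/= in_itv/= ltrBrDl => yz.
exact: le_lt_trans (metric_triangle _ y _) yz.
Qed.

Lemma borel_dirac_nonmeasurable A : ~ measurable A -> borel_dirac A = 0%E.
Proof. by move=> nmA; rewrite /borel_dirac asboolF. Qed.

Definition delta : W2 := MkW2 borel_dirac_moment borel_dirac_nonmeasurable.

End Delta.

HB.instance Definition _ := gen_eqMixin W2.
HB.instance Definition _ := gen_choiceMixin W2.
HB.instance Definition _ := isPointed.Build W2 (delta point).

(* The metric topology of [W], given directly by the balls: this does not need
   the triangle inequality for [W]. *)
Definition W2_open : set (set W2) :=
  [set A | forall mu, A mu ->
    exists2 r : R, 0 < r & [set nu | W mu nu < r] `<=` A].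

Let W2_openT : W2_open setT.
Proof. by move=> mu _; exists 1. Qed.

Let W2_openI A B : W2_open A -> W2_open B -> W2_open (A `&` B).
Proof.
move=> oA oB mu [/oA[r r0 rA] /oB[s s0 sB]].
exists (Num.min r s); first by rewrite lt_min r0.
by move=> nu /=; rewrite lt_min => /andP[/rA ? /sB].
Qed.

Let W2_open_bigU (I : Type) (F : I -> set W2) :
  (forall i, W2_open (F i)) -> W2_open (\bigcup_i F i).
Proof.
move=> oF mu [i _ /oF[r r0 rF]]; exists r => // nu /rF ?.
by exists i.
Qed.

HB.instance Definition _ :=
  isOpenTopological.Build W2 W2_openT W2_openI W2_open_bigU.

(* An asymptote class is a set of unitary rays. *)
Definition asymptote_class (gamma : R -> W2) : set (R -> W2) :=
  [set gamma' | unit_ray W gamma' /\ asymptotic W gamma gamma'].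

Record boundary := MkBoundary {
  boundary_class :> set (R -> W2) ;
  boundary_classP : exists2 gamma, unit_ray W gamma &
    boundary_class = asymptote_class gamma }.

Definition W2bar : Type := (W2 + boundary)%type.

Definition unit_geodesic_to (x : X) (theta : W2bar) : set (R -> W2) :=
  match theta with
  | inl mu => [set gamma | [/\ unit_geodesic W `[0, W (delta x) mu] gamma,
                 gamma 0 = delta x & gamma (W (delta x) mu) = mu]]
  | inr xi => [set gamma | [/\ unit_ray W gamma,
                 gamma 0 = delta x & boundary_class xi gamma]]
  end.

(* [mu_(delta_x, theta)]. [get] chooses a representative of this geodesic, which
   is unique on its interval of definition and is only used
   at times of this interval. *)
Definition geodesic_to (x : X) (theta : W2bar) : R -> W2 :=
  get (unit_geodesic_to x theta).

Definition closed_ball_W2bar (mu : W2) (r : R) : set W2bar :=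
  [set inl nu | nu in [set nu | W mu nu <= r]].

Definition cone_nbhs (x : X) (xi : boundary) (r e : R) : set W2bar :=
  [set theta | ~ closed_ball_W2bar (delta x) r theta /\
    W (geodesic_to x theta r) (geodesic_to x (inr xi) r) < e].

Definition cone_basis (x : X) : set (set W2bar) :=
  [set inl @` A | A in (open : set (set W2))] `|`
  [set U | exists xi r e, [/\ 0 < r, 0 < e & U = cone_nbhs x xi r e]].

(* [W2bar] with the topology generated by [cone_basis x], that is the coarsest
   one for which the elements of [cone_basis x] are open. *)
Definition cone_W2 (x : X) : Type := W2bar.

Section ConeTopology.
Variable x : X.

HB.instance Definition _ := gen_eqMixin (cone_W2 x).
HB.instance Definition _ := gen_choiceMixin (cone_W2 x).
HB.instance Definition _ :=
  @isSubBaseTopological.Build (cone_W2 x) (set W2bar) (cone_basis x) id.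

End ConeTopology.

End Wasserstein.

Definition first_countable (T : topologicalType) : Prop :=
  forall p : T, exists2 B : set (set T), countable B &
    B `<=` nbhs p /\ forall A, nbhs p A -> exists2 V, B V & V `<=` A.

(* Main.v *)
(** Every measure of [W2 X] is the law of a square integrable map from the unit
    interval to [X], and if [f] has law [mu], then [W mu nu] is the infimum of the
    L2 distances from [f] to the maps of law [nu]: a coupling is discretized by a
    countable partition of [X], realized on the unit interval because its measure
    has no atom, and refined along a sequence which converges in L2. So [W2 X] is
    a quotient of the complete space of L2 maps. Hence [W] is a complete metric,
    and every inequality of [X] which is linear in the squared distances can be
    integrated.

    In this way the CAT(0) inequalities with a vertex [x] pass to [W2 X] with a
    vertex [delta x], the homotheties of [X] centred at [x] acting on measures by
    push-forward. This gives the unique geodesic from [delta x] to each measure,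
    and together with the 2-convexity of the squared distance to [delta x] it gives
    the convexity inequality which makes [scale x (r / s) (gamma s)] a Cauchy family
    as [s] tends to infinity, for every unitary ray [gamma]. Its limit is the unique
    ray from [delta x] asymptotic to [gamma], with a rate [r / s * W (delta x) (gamma 0)]
    which also controls the change of base point. The topological statements
    then follow as in a proper CAT(0) space. *)

Require Import Defs.
From HB Require Import structures.
From mathcomp Require Import all_boot all_order all_algebra.
From mathcomp Require Import all_classical all_reals all_analysis.
From mathcomp Require Import measurable_realfun ring lra.

Set Implicit Arguments.
Unset Strict Implicit.
Unset Printing Implicit Defensive.

Import Order.TTheory GRing.Theory Num.Theory.
Import numFieldNormedType.Exports.

Local Open Scope classical_set_scope.
Local Open Scope ring_scope.

(** The obstacle is that [W2 X] is in general not CAT(0), so no comparison is available for an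
    arbitrary triangle of measures. Inequalities of [X] are integrated along maps on the unit
    interval, and lifting provides near-optimal maps only from one given map: distances to this hub
    are bounded from above, those between two other lifts only from below, by [W_le]. Hence an
    inequality passes to measures when each distance that needs an upper bound starts at the hub or
    at a constant map; [W_delta] makes the latter exact, which is why one vertex has to be a Dirac
    mass.

    Lifting also plays the role of gluing in the triangle inequality. Since lifts are only
    near-optimal, the estimates carry an error [e], which [le_lim] removes. The law of a limit of
    lifts has to be identified before [W] is known to be a metric; this is the purpose of the
    Levy-Prokhorov comparison. *)

Local Notation borel X := (g_sigma_algebraType (@open X)).

(** * Borel maps to a separable metric space *)

Section Separable.
Context {R : realType} {X : completePMetricType R}.
Local Notation d := (@mdist R X).

Lemma mdist_lip (x y z : X) : `|d x y - d x z| <= d y z.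
Proof.
have := metric_triangle x y z; have := metric_triangle x z y.
rewrite (metric_sym z y) ler_norml => *; apply/andP; split; lra.
Qed.

Lemma open_mdist (A : set X) :
  (forall x, A x -> exists2 e : R, 0 < e & forall y, d x y < e -> A y) -> open A.
Proof.
move=> h; rewrite openE => x /h[e e0 eA]; apply/nbhs_ballP; exists e => // y.
by rewrite ballEmdist/=; exact: eA.
Qed.

Lemma open_mdistP (A : set X) x : open A -> A x ->
  exists2 e : R, 0 < e & forall y, d x y < e -> A y.
Proof.
rewrite openE => /[apply] /nbhs_ballP[e e0 eA]; exists e => // y xy.
by apply: eA; rewrite ballEmdist.
Qed.

Lemma measurable_openX (A : set X) : open A -> measurable (A : set (borel X)).
Proof. by move=> oA; apply: sub_sigma_algebra. Qed.

Lemma measurable_mdistl (x : X) : measurable_fun setT (fun y : borel X => d x y).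
Proof.
apply: (measurability _ (RGenInftyO.measurableE R)).
move=> _ [_ [a ->] <-]; rewrite setTI; apply: measurable_openX.
apply: open_mdist => y /=; rewrite in_itv/= => xy.
exists (a - d x y); first by rewrite subr_gt0.
by move=> z yz; rewrite in_itv/=; have := metric_triangle x y z; lra.
Qed.

Hypothesis sepX : separable X.

Lemma dense_seq : exists q : nat -> X, forall (y : X) (e : R), 0 < e -> exists n, d (q n) y < e.
Proof.
case: sepX => D cD dD.
have DE y e : 0 < e -> exists2 z, D z & d z y < e.
  move=> e0; have [] := dD (ball y e).
  - by exists y; exact: ballxx.
  - apply: open_mdist => z; rewrite ballEmdist/= => yz.
    exists (e - d y z); first by rewrite subr_gt0.
    by move=> t zt; have := metric_triangle y z t; lra.
  - by move=> z [yz Dz]; exists z => //; move: yz; rewrite ballEmdist/= metric_sym.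
have /pfcard_geP[D0|[q]] := cD.
  by have [z] := DE point 1 ltr01; rewrite D0.
exists q => y e /(DE y)[z Dz zy].
by have [n _ nz] := 'surj_q Dz; exists n; rewrite nz.
Qed.

(** Separability makes an open set [U] the countable union of the balls around [q n] of radius [r k]
    contained in [U]; their preimages are measurable by hypothesis. *)
Lemma measurable_to_borel dO (O : measurableType dO) (f : O -> X) :
  (forall x, measurable_fun setT (fun w => d x (f w))) ->
  measurable_fun setT (f : O -> borel X).
Proof.
move=> mf; apply: (measurability (@open X : set (set (borel X)))) => //.
move=> _ [U oU <-]; rewrite setTI.
have [q qd] := dense_seq.
pose r (k : nat) : R := k.+1%:R^-1.
have r0 k : 0 < r k by rewrite invr_gt0.
rewrite (_ : f @^-1` U = \bigcup_n \bigcup_(k in [set k |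
    forall y : X, d (q n) y < r k -> U y])
    ((fun w => d (q n) (f w)) @^-1` `]-oo, r k[%classic)); last first.
  apply/seteqP; split=> w /=; last first.
    by move=> [n _ [k /= nkU]]; rewrite in_itv/=; exact: nkU.
  move=> /(open_mdistP oU)[e e0 eU].
  have [k ke] : exists k, r k < e / 2.
    near \oo => k; exists k.
    by near: k; apply: near_infty_natSinv_lt (PosNum (divr_gt0 e0 (ltr0Sn _ 1))).
  have [n nk] := qd (f w) _ (r0 k).
  exists n => //; exists k => /=; last by rewrite in_itv.
  move=> y ny; apply: eU; have := metric_triangle (f w) (q n) y.
  by rewrite (metric_sym (f w) (q n)); lra.
apply: bigcup_measurable => n _; apply: bigcup_measurable => k _ /=.
by rewrite -[X in measurable X]setTI; exact: mf.
Unshelve. all: by end_near. Qed.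

(** The domain carries the product of the Borel sigma-algebras, not the Borel sigma-algebra of the
    product. The distance is therefore written as the supremum of [|d (q n) x - d (q n) y|] over a
    dense sequence. *)
Lemma measurable_mdist :
  measurable_fun setT (fun z : borel X * borel X => d z.1 z.2).
Proof.
have [q qd] := dense_seq.
apply: (measurability _ (RGenOInfty.measurableE R)).
move=> _ [_ [a ->] <-]; rewrite setTI.
rewrite (_ : _ @^-1` _ = \bigcup_n
    ((fun z : borel X * borel X => `|d (q n) z.1 - d (q n) z.2|) @^-1` `]a, +oo[%classic)).
  apply: bigcup_measurable => n _; rewrite -[X in measurable X]setTI.
  have : measurable_fun setT
    (fun z : borel X * borel X => `|d (q n) z.1 - d (q n) z.2|).
    apply: measurableT_comp => //; apply: measurable_funB.
      exact: measurableT_comp (measurable_mdistl _) measurable_fst.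
    exact: measurableT_comp (measurable_mdistl _) measurable_snd.
  by apply => //; exact: measurable_itv.
apply/seteqP; split=> -[x y] /=; last first.
  by move=> [n _]; rewrite /= !in_itv/= !andbT => /lt_le_trans; apply; exact: mdist_lip.
rewrite !in_itv/= !andbT => axy.
have [|n nx] := qd x ((d x y - a) / 2); first by lra.
exists n => //=; rewrite in_itv/= andbT distrC.
apply: lt_le_trans (ler_norm _).
by have := metric_triangle x (q n) y; rewrite (metric_sym x (q n)); lra.
Qed.

Lemma measurable_mdist2 dO (O : measurableType dO) (f g : O -> X) :
  measurable_fun setT (f : O -> borel X) -> measurable_fun setT (g : O -> borel X) ->
  measurable_fun setT (fun w => d (f w) (g w)).
Proof.
move=> mf mg.
have -> : (fun w => d (f w) (g w)) =
   (fun z : borel X * borel X => d z.1 z.2) \o (fun w => (f w, g w)) by [].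
by apply: measurableT_comp measurable_mdist _; exact/measurable_fun_pair.
Qed.

End Separable.

(** * Square integrable maps and their laws *)

Record L2map {R : realType} {X : completePMetricType R} {dO} {O : measurableType dO}
    (P : probability O R) := MkL2map {
  L2fun :> O -> X ;
  L2_measurable : measurable_fun setT (L2fun : O -> borel X) ;
  L2_moment : (\int[P]_w (@mdist R X point (L2fun w) ^+ 2)%:E < +oo)%E }.
Arguments L2map {R} X {dO O} P.

Definition sqdist {R : realType} {X : completePMetricType R} {dO} {O : measurableType dO}
    (P : probability O R) (f g : O -> X) : R :=
  \int[P]_w (@mdist R X (f w) (g w) ^+ 2).

Section L2.
Context {R : realType} {X : completePMetricType R}.
Local Notation d := (@mdist R X).
Hypothesis sepX : separable X.
Context {dO} {O : measurableType dO} (P : probability O R).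
Implicit Types f g h : L2map X P.

Lemma sqr_mdist_le (x y z : X) : d x y ^+ 2 <= 2 * (d z x ^+ 2 + d z y ^+ 2).
Proof.
have xy := metric_triangle x z y; rewrite (metric_sym x z) in xy.
have h : d x y ^+ 2 <= (d z x + d z y) ^+ 2.
  by rewrite ler_pXn2r ?nnegrE ?addr_ge0 ?mdist_ge0.
have := sqr_ge0 (d z x - d z y); lra.
Qed.

Lemma measurable_sqdist f g : measurable_fun setT (fun w => d (f w) (g w) ^+ 2).
Proof.
by apply: measurable_funX; apply: measurable_mdist2 => //; exact: L2_measurable.
Qed.

Lemma integrable_sqdist f g :
  P.-integrable setT (EFin \o (fun w => d (f w) (g w) ^+ 2)).
Proof.
have i0 f' : P.-integrable setT (EFin \o (fun w => d point (f' w) ^+ 2)).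
  apply/integrableP; split.
    apply/measurable_EFinP; apply: measurable_funX.
    exact: measurableT_comp (measurable_mdistl point) (L2_measurable f').
  rewrite (eq_integral (fun w => (d point (f' w) ^+ 2)%:E)).
    exact: L2_moment.
  by move=> w _ /=; rewrite ger0_norm// sqr_ge0.
apply: (@le_integrable _ _ _ P setT measurableT _
   (fun w => 2%:E * ((d point (f w) ^+ 2)%:E + (d point (g w) ^+ 2)%:E))%E).
- by apply/measurable_EFinP; exact: measurable_sqdist.
- move=> w _ /=; rewrite lee_fin ger0_norm ?sqr_ge0//.
  rewrite ger0_norm; first exact: sqr_mdist_le.
  by rewrite mulr_ge0// addr_ge0// sqr_ge0.
- by apply: integrableZl => //; apply: integrableD => //; exact: i0.
Qed.

Lemma sqdistE f g : (\int[P]_w (d (f w) (g w) ^+ 2)%:E)%E = (sqdist P f g)%:E.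
Proof.
rewrite /sqdist /Rintegral fineK//.
exact: integrable_fin_num (integrable_sqdist f g).
Qed.

(* An inequality between linear combinations of squared distances is integrated:
   a triple [(c, f, g)] stands for [c * d f g ^+ 2]. *)
Lemma sqdist_lincomb (s : seq (R * L2map X P * L2map X P)) :
  (forall w, 0 <= \sum_(t <- s) t.1.1 * d (t.1.2 w) (t.2 w) ^+ 2) ->
  0 <= \sum_(t <- s) t.1.1 * sqdist P t.1.2 t.2.
Proof.
move=> s0.
suff [_ <-] : P.-integrable setT
      (EFin \o (fun w => \sum_(t <- s) t.1.1 * d (t.1.2 w) (t.2 w) ^+ 2)) /\
    \int[P]_w (\sum_(t <- s) t.1.1 * d (t.1.2 w) (t.2 w) ^+ 2) =
    \sum_(t <- s) t.1.1 * sqdist P t.1.2 t.2.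
  by apply: Rintegral_ge0 => w _; exact: s0.
elim: s {s0} => [|[[c f] g] s [IH1 IH2]].
  rewrite big_nil; split.
    by apply: eq_integrable (integrable0 P setT) => // w _ /=; rewrite big_nil.
  by rewrite (@eq_Rintegral _ _ _ _ _ (cst 0)) ?Rintegral_cst ?mul0r// => w _; rewrite big_nil.
have ic : P.-integrable setT (EFin \o (fun w => c * d (f w) (g w) ^+ 2)).
  apply: eq_integrable (integrableZl measurableT c (integrable_sqdist f g)) => //.
split.
  apply: eq_integrable (integrableD measurableT ic IH1) => // w _ /=.
  by rewrite big_cons EFinD.
rewrite big_cons/= -IH2 -RintegralZl//; last exact: integrable_sqdist.
rewrite -RintegralD//.
by apply: eq_Rintegral => w _; rewrite big_cons.
Qed.

Lemma sqdist_ge0 (f g : O -> X) : 0 <= sqdist P f g.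
Proof. by apply: Rintegral_ge0 => w _; rewrite sqr_ge0. Qed.

Lemma sqdist_sym (f g : O -> X) : sqdist P f g = sqdist P g f.
Proof. by apply: eq_Rintegral => w _; rewrite metric_sym. Qed.

Lemma sqdistxx (f : O -> X) : sqdist P f f = 0.
Proof.
rewrite /sqdist (@eq_Rintegral _ _ _ _ _ (cst 0)) ?Rintegral_cst ?mul0r// => w _.
by rewrite mdistxx expr0n.
Qed.

(** Minkowski's inequality in a form that [sqdist_lincomb] can integrate: the weighted
    Cauchy-Schwarz inequality bounds [(x + y) ^+ 2] by a linear combination of [x ^+ 2] and
    [y ^+ 2]. The parameter [e] keeps the denominators positive when [a] or [b] vanishes. *)
Lemma sqdist_triangle f g h :
  Num.sqrt (sqdist P f h) <= Num.sqrt (sqdist P f g) + Num.sqrt (sqdist P g h).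
Proof.
pose a : R := Num.sqrt (sqdist P f g); pose b : R := Num.sqrt (sqdist P g h).
rewrite -[X in _ <= X]/(a + b).
have a0 : 0 <= a by exact: sqrtr_ge0.
have b0 : 0 <= b by exact: sqrtr_ge0.
have aE : sqdist P f g = a ^+ 2 by rewrite sqr_sqrtr// sqdist_ge0.
have bE : sqdist P g h = b ^+ 2 by rewrite sqr_sqrtr// sqdist_ge0.
suff key (e : R) : 0 < e -> sqdist P f h <= (a + b + 2 * e) ^+ 2.
  apply/ler_addgt0Pr => e e0; rewrite -[e]/(e : R).
  rewrite -[leRHS]ger0_norm; last by lra.
  rewrite -sqrtr_sqr; apply: ler_wsqrtr.
  by rewrite (_ : e = 2 * (e / 2)); [apply: key; rewrite divr_gt0|rewrite mulrC divfK].
move=> e0.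
pose s := [:: ((a + b + 2 * e) / (a + e), f, g); ((a + b + 2 * e) / (b + e), g, h);
              (-1, f, h)].
have : 0 <= \sum_(t <- s) t.1.1 * sqdist P t.1.2 t.2.
  apply: sqdist_lincomb => w; rewrite /s !big_cons big_nil/= addr0.
  have := metric_triangle (f w) (g w) (h w).
  have := mdist_ge0 (f w) (h w).
  move: (d _ _) (d (f w) (g w)) (d (g w) (h w)) => z x y z0 zxy.
  apply: (@le_trans _ _ ((a + b + 2 * e) / (a + e) * x ^+ 2 +
     ((a + b + 2 * e) / (b + e) * y ^+ 2) - (x + y) ^+ 2)); last by nra.
  rewrite (_ : _ - _ = ((b + e) * x - (a + e) * y) ^+ 2 / ((a + e) * (b + e))).
    by rewrite divr_ge0// ?sqr_ge0// mulr_ge0//; lra.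
  by field; rewrite !gt_eqF//; lra.
rewrite /s !big_cons big_nil/= addr0 aE bE => H.
apply: (@le_trans _ _ ((a + b + 2 * e) / (a + e) * a ^+ 2 +
     (a + b + 2 * e) / (b + e) * b ^+ 2)); first by lra.
rewrite -subr_ge0.
rewrite (_ : _ - _ = (a + b + 2 * e) * (2 * e - (a / (a + e) * a - a) - (b / (b + e) * b - b))).
  apply: mulr_ge0; first by lra.
  have ha : a / (a + e) <= 1 by rewrite ler_pdivrMr; lra.
  have hb : b / (b + e) <= 1 by rewrite ler_pdivrMr; lra.
  nra.
by field; rewrite !gt_eqF//; lra.
Qed.

Lemma cst_moment (x : X) : (\int[P]_w (d point (cst x w) ^+ 2)%:E < +oo)%E.
Proof.
rewrite (eq_integral (cst (d point x ^+ 2)%:E))//.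
by rewrite integral_cst// [X in (_ * X)%E](@probability_setT _ _ _ P) mule1 ltry.
Qed.

Definition cstL2 x : L2map X P := MkL2map (measurable_cst (x : borel X)) (cst_moment x).

Lemma comp_measurable (p : X -> X) (f : L2map X P) :
  measurable_fun setT (p : borel X -> borel X) ->
  measurable_fun setT (p \o f : O -> borel X).
Proof. by move=> mp; apply: measurableT_comp mp (L2_measurable f). Qed.

Lemma comp_moment (p : X -> X) (A K : R) (f : L2map X P) :
  measurable_fun setT (p : borel X -> borel X) ->
  (forall y, d point (p y) <= A + K * d point y) ->
  (\int[P]_w (d point ((p \o f) w) ^+ 2)%:E < +oo)%E.
Proof.
move=> mp pAK.
apply: (@integrable_lty _ _ _ P setT measurableT (fun w => (d point (p (f w)) ^+ 2)%:E)).
apply: (@le_integrable _ _ _ P setT measurableT _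
   (fun w => (2 * A ^+ 2)%:E + (2 * K ^+ 2)%:E * (d (cstL2 point w) (f w) ^+ 2)%:E)%E).
- apply/measurable_EFinP; apply: measurable_funX.
  exact: measurableT_comp (measurable_mdistl point) (comp_measurable f mp).
- move=> w _ /=; rewrite lee_fin ger0_norm ?sqr_ge0//.
  rewrite ger0_norm; last first.
    by rewrite addr_ge0// mulr_ge0 ?sqr_ge0// mulr_ge0// sqr_ge0.
  have h : d point (p (f w)) ^+ 2 <= (A + K * d point (f w)) ^+ 2.
    have := pAK (f w); have := mdist_ge0 point (p (f w)).
    by move=> ? ?; rewrite ler_pXn2r ?nnegrE//; lra.
  by have := sqr_ge0 (A - K * d point (f w)); lra.
- apply: integrableD => //.
    exact: finite_measure_integrable_cst.
  by apply: integrableZl => //; exact: integrable_sqdist.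
Qed.

End L2.

Section Law.
Context {R : realType} {X : completePMetricType R}.
Local Notation d := (@mdist R X).
Context {dO} {O : measurableType dO} (P : probability O R).
Variable f : L2map X P.

Definition law_fun (A : set (borel X)) : \bar R :=
  if `[< measurable A >] then P (f @^-1` A) else 0%E.

Let mf (A : set (borel X)) : measurable A -> measurable (f @^-1` A).
Proof. by move=> mA; rewrite -[X in measurable X]setTI; apply: L2_measurable. Qed.

Let law_funE (A : set (borel X)) : measurable A -> law_fun A = P (f @^-1` A).
Proof. by move=> mA; rewrite /law_fun asboolT. Qed.

Let law_fun0 : law_fun set0 = 0%E.
Proof. by rewrite law_funE// preimage_set0 measure0. Qed.

Let law_fun_ge0 A : (0 <= law_fun A)%E.
Proof. by rewrite /law_fun; case: ifP. Qed.

Let law_fun_sigma_additive : semi_sigma_additive law_fun.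
Proof.
move=> F mF tF mUF; rewrite law_funE//.
under eq_fun do under eq_bigr do rewrite law_funE//.
rewrite preimage_bigcup.
apply: measure_semi_sigma_additive.
- by move=> n; exact: mf.
- apply/trivIsetP => i j _ _ ij; rewrite -preimage_setI.
  by move/trivIsetP : tF => ->//; rewrite preimage_set0.
- by rewrite -preimage_bigcup; exact: mf.
Qed.

HB.instance Definition _ := isMeasure.Build _ _ _ law_fun
  law_fun0 law_fun_ge0 law_fun_sigma_additive.

Let law_funT : law_fun setT = 1%E.
Proof. by rewrite law_funE// preimage_setT probability_setT. Qed.

HB.instance Definition _ :=
  Measure_isProbability.Build _ _ _ law_fun law_funT.

Lemma integral_law_fun (phi : X -> \bar R) :
  measurable_fun setT (phi : borel X -> \bar R) -> (forall y, 0 <= phi y)%E ->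
  (\int[law_fun]_y phi y = \int[P]_w phi (f w))%E.
Proof.
move=> mphi phi0.
rewrite -[RHS]/(\int[P]_(w in f @^-1` setT) (phi \o f) w)%E.
rewrite -(@ge0_integral_pushforward _ _ _ _ _ _ (L2_measurable f) P setT phi)//.
apply: eq_measure_integral => [|? A mA _]; [exact: L2_measurable|exact: law_funE].
Qed.

Lemma law_fun_moment : finite_second_moment law_fun.
Proof.
exists point; rewrite integral_law_fun.
- exact: L2_moment.
- by apply/measurable_EFinP; apply: measurable_funX; exact: measurable_mdistl.
- by move=> y; rewrite lee_fin sqr_ge0.
Qed.

Lemma law_fun_nonmeasurable A : ~ measurable A -> law_fun A = 0%E.
Proof. by move=> nmA; rewrite /law_fun asboolF. Qed.

Definition law : W2 X := MkW2 law_fun_moment law_fun_nonmeasurable.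

Lemma lawE (A : set (borel X)) : measurable A -> law A = P (f @^-1` A).
Proof. exact: law_funE. Qed.

Lemma integral_law (phi : X -> \bar R) :
  measurable_fun setT (phi : borel X -> \bar R) -> (forall y, 0 <= phi y)%E ->
  (\int[law]_y phi y = \int[P]_w phi (f w))%E.
Proof. exact: integral_law_fun. Qed.

End Law.

(** * Couplings and laws of pairs of maps *)

Section WL2.
Context {R : realType} {X : completePMetricType R}.
Local Notation d := (@mdist R X).
Local Notation BX := (borel X : measurableType _).
Hypothesis sepX : separable X.

(** The mixins of a probability contain only proofs, so proof irrelevance identifies two structures
    over the same set function. *)
Lemma eq_probability dT (T : measurableType dT) (P1 P2 : probability T R) :
  (P1 = P2 :> (set T -> \bar R)) -> P1 = P2.
Proof.
case: P1 P2 => [P1 [[a1 b1] [c1] [d1] [e1] [f1] [g1] [h1]]]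
  [P2 [[a2 b2] [c2] [d2] [e2] [f2] [g2] [h2]]] /= P12.
move: a2 b2 c2 d2 e2 f2 g2 h2; rewrite -{}P12 => a2 b2 c2 d2 e2 f2 g2 h2.
rewrite (Prop_irrelevance a2 a1) (Prop_irrelevance b2 b1) (Prop_irrelevance c2 c1)
  (Prop_irrelevance d2 d1) (Prop_irrelevance e2 e1) (Prop_irrelevance f2 f1).
by rewrite (Prop_irrelevance g2 g1) (Prop_irrelevance h2 h1).
Qed.

Lemma W2_ext (mu nu : W2 X) :
  (forall A : set (borel X), measurable A -> mu A = nu A) -> mu = nu.
Proof.
move=> h.
have {h} e : W2_prob mu = W2_prob nu.
  apply: eq_probability; apply/funext => A.
  have [/h//|nA] := pselect (measurable (A : set (borel X))).
  by rewrite !W2_nonmeasurable.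
case: mu nu e => [m m1 m2] [n n1 n2] /= e.
by move: m1 m2; rewrite e => m1 m2; f_equal; exact: Prop_irrelevance.
Qed.

Lemma id_moment (mu : W2 X) : (\int[mu]_y (d point (@idfun X y) ^+ 2)%:E < +oo)%E.
Proof.
have [x0 h] := W2_moment mu.
pose g (x : X) (y : borel X) : \bar R := (d x y ^+ 2)%:E.
have mg x : measurable_fun setT (g x : borel X -> \bar R).
  by apply/measurable_EFinP; apply: measurable_funX; exact: measurable_mdistl.
have g0 x y : (0 <= g x y)%E by rewrite lee_fin sqr_ge0.
have ig : (W2_prob mu).-integrable setT (g x0).
  apply/integrableP; split; first exact: mg.
  by rewrite (eq_integral (g x0))// => y _; rewrite gee0_abs.
apply: (@integrable_lty _ _ _ (W2_prob mu) setT measurableT (g point)).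
apply: (@le_integrable _ _ _ (W2_prob mu) setT measurableT _
   (fun y => (2 * d x0 point ^+ 2)%:E + 2%:E * g x0 y)%E) => //.
- move=> y _; rewrite /g /= lee_fin ger0_norm ?sqr_ge0// ger0_norm; last first.
    by rewrite addr_ge0// mulr_ge0// sqr_ge0.
  have := sqr_mdist_le point y x0; lra.
- apply: integrableD => //; last exact: integrableZl.
  exact: finite_measure_integrable_cst.
Qed.

(** The measure itself serves as the probability space; this presents any element of [W2 X] as a
    law. *)
Definition idL2 (mu : W2 X) : L2map X (W2_prob mu) :=
  MkL2map (@measurable_id _ BX setT) (id_moment mu).

Lemma law_idL2 mu : law (idL2 mu) = mu.
Proof. by apply: W2_ext => A mA; rewrite lawE. Qed.

Section Joint.
Context {dO} {O : measurableType dO} (P : probability O R).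
Implicit Types f g : L2map X P.

Lemma law_eqP f g : law f = law g ->
  forall A : set (borel X), measurable A -> P (f @^-1` A) = P (g @^-1` A).
Proof. by move=> fg A mA; rewrite -!lawE// fg. Qed.

Lemma joint_law f g : exists pi : probability (BX * BX)%type R,
  coupling (law f) (law g) pi /\
  (\int[pi]_z (d z.1 z.2 ^+ 2)%:E)%E = (sqdist P f g)%:E.
Proof.
have mfg : measurable_fun setT (fun w => (f w, g w) : (BX * BX)%type).
  by apply/measurable_fun_pair; exact: L2_measurable.
pose fg : {mfun O >-> (BX * BX)%type} := HB.pack (fun w => (f w, g w) : (BX * BX)%type)
  (isMeasurableFun.Build _ _ _ _ _ mfg).
exists (distribution P fg); split.
  move=> A mA; rewrite !lawE//.
  by split; rewrite /distribution/= /pushforward; congr (P _);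
    apply/seteqP; split => w //= [].
rewrite (@ge0_integral_distribution _ _ _ _ _ P fg (fun z => (d z.1 z.2 ^+ 2)%:E))//.
- by rewrite -sqdistE.
- by apply/measurable_EFinP; apply: measurable_funX; exact: measurable_mdist.
- by move=> z; rewrite lee_fin sqr_ge0.
Qed.

Lemma W_le f g : W (law f) (law g) <= Num.sqrt (sqdist P f g).
Proof.
have [pi [cpi piE]] := joint_law f g.
apply: ler_wsqrtr; rewrite -[leRHS]/(fine (sqdist P f g)%:E) -piE.
set I := ereal_inf _.
have I0 : (0 <= I)%E.
  apply: le_ereal_inf_tmp => _ [pi' _ <-].
  by apply: integral_ge0 => z _; rewrite lee_fin sqr_ge0.
have Ile : (I <= \int[pi]_z (d z.1 z.2 ^+ 2)%:E)%E.
  by apply: ereal_inf_lbound; exists pi.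
apply: fine_le => //; last by rewrite piE.
by rewrite ge0_fin_numE// (le_lt_trans Ile)// piE ltry.
Qed.

End Joint.

Lemma W_ge0 (mu nu : W2 X) : 0 <= W mu nu.
Proof. exact: sqrtr_ge0. Qed.

Lemma coupling_law (mu nu : W2 X) (pi : probability (BX * BX)%type R) :
  coupling mu nu pi -> exists f g : L2map X pi,
  [/\ law f = mu, law g = nu & forall z, f z = z.1 /\ g z = z.2].
Proof.
move=> c.
have mom (m : W2 X) (k : (BX * BX)%type -> BX) (mk : measurable_fun setT k) :
    (forall A : set (borel X), measurable A -> pi (k @^-1` A) = m A) ->
    exists f : L2map X pi, law f = m /\ forall z, f z = k z.
  move=> h.
  have km : (\int[pi]_z (d point (k z) ^+ 2)%:E < +oo)%E.
    apply: le_lt_trans (id_moment m).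
    pose phi (y : borel X) : \bar R := (d point y ^+ 2)%:E.
    rewrite -[leLHS]/(\int[pi]_(z in k @^-1` setT) (phi \o k) z)%E.
    rewrite -(@ge0_integral_pushforward _ _ _ _ _ _ mk pi setT phi)//.
    - rewrite (eq_measure_integral (W2_prob m))// => A mA _; exact: h.
    - by apply/measurable_EFinP; apply: measurable_funX; exact: measurable_mdistl.
    - by move=> y _; rewrite lee_fin sqr_ge0.
  exists (MkL2map mk km); split => //.
  by apply: W2_ext => A mA; rewrite lawE//= h.
have [|f [fm fE]] := mom mu fst (@measurable_fst _ _ _ _).
  move=> A /c[<- _]; congr (pi _).
  by apply/seteqP; split => z //= [].
have [|g [gm gE]] := mom nu snd (@measurable_snd _ _ _ _).
  move=> A /c[_ <-]; congr (pi _).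
  by apply/seteqP; split => z //= [].
by exists f, g.
Qed.

(** Without any coupling the infimum would be [+oo], and [fine] would make [W mu nu] equal to 0; the
    first hypothesis excludes this. *)
Lemma W_lt (mu nu : W2 X) (a : R) :
  (exists pi, coupling mu nu pi) -> W mu nu < a ->
  exists (pi : probability (BX * BX)%type R) (f g : L2map X pi),
    [/\ law f = mu, law g = nu & Num.sqrt (sqdist pi f g) < a].
Proof.
move=> [pi0 c0]; rewrite /W; set S := [set _ | _ in _] => Wa.
have a0 : 0 < a := le_lt_trans (sqrtr_ge0 _) Wa.
have cost (pi : probability (BX * BX)%type R) (f g : L2map X pi) :
    (forall z, f z = z.1 /\ g z = z.2) ->
    (\int[pi]_z (d z.1 z.2 ^+ 2)%:E)%E = (sqdist pi f g)%:E.
  move=> fg; rewrite -sqdistE//; apply: eq_integral => z _.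
  by have [-> ->] := fg z.
have I0 : (0 <= ereal_inf S)%E.
  apply: le_ereal_inf_tmp => _ [pi' _ <-].
  by apply: integral_ge0 => z _; rewrite lee_fin sqr_ge0.
have Ifin : ereal_inf S \is a fin_num.
  rewrite ge0_fin_numE//.
  have [f [g [_ _ fg]]] := coupling_law c0.
  apply: (@le_lt_trans _ _ (sqdist pi0 f g)%:E); last exact: ltry.
  by apply: ereal_inf_lbound; exists pi0 => //; exact: cost.
have : (ereal_inf S < (a ^+ 2)%:E)%E.
  rewrite -(fineK Ifin) lte_fin.
  rewrite ltNge; apply/negP => aI; move: Wa; rewrite ltNge => /negP; apply.
  by rewrite -(ger0_norm (ltW a0)) -sqrtr_sqr; exact: ler_wsqrtr.
move=> /ereal_inf_lt[_ [pi cpi <-] lta].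
have [f [g [fm gm fg]]] := coupling_law cpi.
exists pi, f, g; split => //.
move: lta; rewrite (cost _ _ _ fg) lte_fin => lta.
rewrite -(ger0_norm (ltW a0)) -sqrtr_sqr ltr_sqrt// exprn_gt0//.
Qed.

End WL2.

(** * Realizing couplings on the unit interval *)

Section Atomless.
Context {R : realType}.
Local Notation Om := (measurableTypeR R).

Definition unif : probability Om R := uniform_prob (@ltr01 R).

Lemma unifE (A : set Om) : measurable A ->
  unif A = lebesgue_measure (A `&` `[0, 1]%classic).
Proof.
move=> mA; rewrite /unif/= /uniform_prob integral_uniform_pdf.
rewrite (eq_integral (cst 1%E)) ?integral_cst ?mul1e//.
  exact: measurableI.
move=> x; rewrite inE => -[_] /=; rewrite in_itv/= => x01.
by rewrite /uniform_pdf x01 subr0 invr1.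
Qed.

Section Cdf.
Variable A : set Om.
Hypothesis mA : measurable A.

Let F (t : R) : R := fine (unif (A `&` `]-oo, t]%classic)).

Let mAt (t : R) : measurable (A `&` `]-oo, t]%classic).
Proof. exact: measurableI. Qed.

Let FE s t : s <= t -> unif (A `&` `]s, t]%classic) = (F t - F s)%:E.
Proof.
move=> st; rewrite EFinB !fineK ?fin_num_measure//.
have -> : A `&` `]s, t]%classic =
    (A `&` `]-oo, t]%classic) `\` (A `&` `]-oo, s]%classic).
  apply/seteqP; split=> x /=; rewrite !in_itv/=.
    move=> [Ax /andP[sx xt]]; split; first by split.
    by move=> [_ xs]; move: sx; rewrite ltNge xs.
  move=> [[Ax xt] n]; split => //; rewrite xt andbT ltNge; apply/negP => xs.
  by apply: n; split.
rewrite measureD//; last by rewrite ltey_eq fin_num_measure.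
congr (_ - unif _)%E; apply/seteqP; split=> x /=; rewrite !in_itv/=.
  by move=> [_ [? ?]]; split.
by move=> [Ax xs]; do ! split => //; exact: le_trans st.
Qed.

Let F_mono s t : s <= t -> F s <= F t.
Proof.
by move=> st; rewrite -subr_ge0 -lee_fin -FE.
Qed.

Let F_lip s t : s <= t -> F t - F s <= t - s.
Proof.
move=> st; rewrite -lee_fin -FE// unifE; last exact: measurableI.
apply: (@le_trans _ _ (lebesgue_measure (`]s, t]%classic : set Om))).
  apply: le_measure; rewrite ?inE//; last by move=> x [[]].
  by apply: measurableI => //; exact: measurableI.
by rewrite lebesgue_measure_itv/= lte_fin; case: ifPn => // _; rewrite lee_fin subr_ge0.
Qed.

Let F_cont : continuous F.
Proof.
move=> x; apply/cvgrPdist_le => e e0; near=> y.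
have : `|x - y| <= e by near: y; apply: cvgr_dist_le.
apply: le_trans; have [xy|/ltW yx] := leP x y.
  rewrite distrC (distrC x) !ger0_norm ?subr_ge0//; [exact: F_lip|exact: F_mono].
by rewrite !ger0_norm ?subr_ge0//; [exact: F_lip|exact: F_mono].
Unshelve. all: by end_near. Qed.

Let F0 : F 0 = 0.
Proof.
rewrite /F unifE//; apply/eqP; rewrite -eqe fineK; last first.
  by rewrite -unifE// fin_num_measure.
rewrite eq_le measure_ge0 andbT.
apply: (@le_trans _ _ (lebesgue_measure [set (0 : R)])); last first.
  by rewrite lebesgue_measure_set1.
apply: le_measure; rewrite ?inE//; first exact: measurableI.
by move=> x /= [[_]]; rewrite !in_itv/= => x0 /andP[x1 _]; apply/eqP; rewrite eq_le x0.
Qed.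

Let F1 : (F 1)%:E = unif A.
Proof.
rewrite fineK ?fin_num_measure// !unifE//; congr lebesgue_measure.
apply/seteqP; split => x /=; rewrite !in_itv/=; first by move=> [[]].
by move=> [Ax /andP[x0 x1]]; rewrite x1 x0.
Qed.

(** The cumulative mass [F] of [A] is 1-Lipschitz, so the intermediate value theorem gives quantiles
    at the partial sums [c j], and each [B j] is the slice of [A] between two consecutive quantiles.
    The slices may miss a null subset of [A]. *)
Lemma unif_split (p : nat -> R) : (forall j, 0 <= p j) ->
  (\sum_(j <oo) (p j)%:E = unif A)%E ->
  exists B : nat -> set Om, [/\ forall j, measurable (B j), trivIset setT B,
    forall j, B j `<=` A & forall j, unif (B j) = (p j)%:E].
Proof.
move=> p0 pA.
pose c j := \sum_(0 <= k < j) p k.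
have c0 j : 0 <= c j by apply: sumr_ge0.
have c1 j : c j <= F 1.
  rewrite -lee_fin F1 -pA -sumEFin.
  by apply: nneseries_lim_ge => k _ _; rewrite lee_fin.
have cS j : c j.+1 = c j + p j by rewrite /c big_nat_recr.
have cmono i j : (i <= j)%N -> c i <= c j.
  by elim: j i => [|j IH] i; [rewrite leqn0 => /eqP->|
    rewrite leq_eqVlt => /orP[/eqP->//|/IH/le_trans]; apply; rewrite cS lerDl].
pose t v := get [set x | F x = v].
have tP v : 0 <= v <= F 1 -> F (t v) = v.
  move=> v01; apply: (@getPex _ [set x | F x = v]).
  have [x _ xv] : exists2 x, x \in `[0, 1] & F x = v.
    apply: IVT => //; first exact: continuous_subspaceT.
    by rewrite F0 min_l ?max_r//; move: v01 => /andP[/le_trans]; apply.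
  by exists x.
have tc j : F (t (c j)) = c j by apply: tP; rewrite c0 c1.
(* Where [F] is flat a quantile is not unique; but [t] depends only on the level, so equal levels
   have equal quantiles. *)
have tmono i j : (i <= j)%N -> t (c i) <= t (c j).
  move=> ij; rewrite leNgt; apply/negP => ji.
  have : c i = c j.
    by apply/eqP; rewrite eq_le cmono//= -(tc i) -(tc j) F_mono// ltW.
  by move=> cij; move: ji; rewrite cij ltxx.
exists (fun j => A `&` `]t (c j), t (c j.+1)]%classic); split.
- by move=> j; apply: measurableI.
- apply: ltn_trivIset => n m nm; rewrite -subset0 => x /= [[_]].
  rewrite !in_itv/= => /andP[_ h2] [_ /andP[h1 _]].
  by have := lt_le_trans h1 (le_trans h2 (tmono _ _ nm)); rewrite ltxx.
- by move=> j x [].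
- by move=> j; rewrite FE ?tmono// !tc cS addrC addKr.
Qed.

End Cdf.

End Atomless.

(** * Completeness of the space of L2 maps *)

Section Completeness.
Context {R : realType} {X : completePMetricType R}.
Local Notation d := (@mdist R X).

Lemma geometric_dist (T : Type) (dist : T -> T -> R) (a : nat -> T) (k : R) :
  (forall x, dist x x = 0) ->
  (forall x y z, dist x z <= dist x y + dist y z) -> 0 <= k ->
  (forall n, dist (a n) (a n.+1) <= k / 2 ^+ n) ->
  forall n m, (n <= m)%N -> dist (a n) (a m) <= 2 * k / 2 ^+ n.
Proof.
move=> dxx tri k0 ak n m nm; rewrite -(subnKC nm).
(* Subtracting the tail of the geometric series gives a bound that is stable under induction. *)
apply: (@le_trans _ _ (2 * k / 2 ^+ n - 2 * k / 2 ^+ (n + (m - n)))); last first.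
  by rewrite gerBl divr_ge0 ?exprn_ge0// mulr_ge0.
elim: (m - n)%N => [|j IH]; first by rewrite addn0 dxx subrr.
apply: le_trans (tri _ (a (n + j)%N) _) _.
have := ak (n + j)%N; rewrite addnS.
have -> : 2 * k / 2 ^+ (n + j).+1 = k / 2 ^+ (n + j).
  by rewrite exprS invfM mulrACA mulfV// mul1r.
move: (dist _ _) (dist _ _) IH => x y; rewrite -!mulrA; lra.
Qed.

Lemma geometric_small (k e : R) : 0 < e -> exists n : nat, k / 2 ^+ n < e.
Proof.
move=> e0.
have [n _ nk] : exists2 n : nat, true & k / e < n%:R.
  near \oo => n; exists n => //; near: n; exact: nbhs_infty_gtr.
exists n; rewrite ltr_pdivrMr ?exprn_gt0// -ltr_pdivrMl// mulrC.
apply: (lt_trans nk); rewrite -natrX ltr_nat; exact: ltn_expl.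
Unshelve. all: by end_near. Qed.

(** The convergence of the distances to every point is what later gives the measurability of a
    pointwise limit, through [measurable_to_borel]. *)
Lemma geometric_cvg (a : nat -> X) (k : R) : 0 <= k ->
  (forall n, d (a n) (a n.+1) <= k / 2 ^+ n) ->
  exists l, (forall n, d (a n) l <= 2 * k / 2 ^+ n) /\
    forall x, d x \o a @ \oo --> d x l.
Proof.
move=> k0 ak.
have aa n m : (n <= m)%N -> d (a n) (a m) <= 2 * k / 2 ^+ n.
  by apply: (geometric_dist (dist := d)) => //; [exact: mdistxx|exact: metric_triangle].
have : cvg (a @ \oo).
  apply/cauchy_cvgP/cauchy_exP => e e0.
  have [n ne] := geometric_small (2 * k) e0.
  exists (a n); suff : \forall m \near \oo, ball (a n) e (a m) by [].
  near=> m; rewrite /= ballEmdist/=; apply: le_lt_trans ne.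
  by apply: aa; near: m; exact: nbhs_infty_ge.
move=> /cvg_ex[l al]; exists l.
have xl x : d x \o a @ \oo --> d x l.
  apply/cvgrPdist_lt => e e0; near=> m.
  apply: le_lt_trans (mdist_lip x l (a m)) _.
  have : ball l e (a m) by near: m; move/cvg_ballP : al; apply.
  by rewrite ballEmdist.
split => // n; have := xl (a n); move/cvg_lim => <-//.
apply: limr_le; first by apply/cvg_ex; exists (d (a n) l); exact: xl.
by near=> m; apply: aa; near: m; exact: nbhs_infty_ge.
Unshelve. all: by end_near. Qed.

Hypothesis sepX : separable X.

Lemma geometric_nneseries (c : R) : 0 <= c ->
  (\sum_(k <oo) (c / 2 ^+ k)%:E <= (2 * c)%:E)%E.
Proof.
move=> c0; apply: lime_le.
  by apply: is_cvg_nneseries => n _ _; rewrite lee_fin divr_ge0// exprn_ge0.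
apply: nearW => n; rewrite sumEFin lee_fin.
apply: (@le_trans _ _ (2 * c - 2 * c / 2 ^+ n)); last first.
  by rewrite gerBl divr_ge0 ?exprn_ge0// mulr_ge0.
elim: n => [|n IH]; first by rewrite big_geq// expr0 divr1 subrr.
rewrite big_nat_recr//=.
have -> : 2 * c / 2 ^+ n.+1 = c / 2 ^+ n.
  by rewrite exprS invfM mulrACA mulfV// mul1r.
by move: (\sum_(_ <= _ < _) _) IH => x; rewrite -!mulrA; lra.
Qed.

(* The integral of [\sum_k 4 ^ k * d (f k) (f k.+1) ^+ 2] is finite, so this sum is
   finite almost everywhere and bounds a geometric rate of pointwise convergence. *)
Lemma L2_geometric_cvg dO (O : measurableType dO) (P : probability O R)
    (f : nat -> L2map X P) (c : R) : 0 <= c ->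
  (forall n, sqdist P (f n) (f n.+1) <= c / 2 ^+ n / (2 ^+ n) ^+ 2) ->
  exists g : L2map X P, forall n, sqdist P (f n) g <= 8 * c / (2 ^+ n) ^+ 2.
Proof.
move=> c0 fc.
pose u k w : \bar R := ((2 ^+ k) ^+ 2 * d (f k w) (f k.+1 w) ^+ 2)%:E.
have u0 k w : (0 <= u k w)%E by rewrite lee_fin mulr_ge0// sqr_ge0.
have mu k : measurable_fun setT (u k).
  apply/measurable_EFinP; apply: measurable_funM => //; exact: measurable_sqdist.
pose K w : \bar R := (\sum_(k <oo) u k w)%E.
have K0 w : (0 <= K w)%E by apply: nneseries_ge0.
have mK : measurable_fun setT K.
  by apply: (@ge0_emeasurable_sum _ _ _ setT u xpredT).
have intK : (\int[P]_w K w <= (2 * c)%:E)%E.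
  rewrite integral_nneseries//.
  apply: le_trans (geometric_nneseries c0); apply: lee_nneseries => // k _.
    by move=> _; apply: integral_ge0 => w _; exact: u0.
  rewrite /u; under eq_integral do rewrite EFinM.
  rewrite ge0_integralZl//=.
  - rewrite sqdistE// -EFinM lee_fin -ler_pdivlMl ?exprn_gt0// mulrC; exact: fc.
  - by apply/measurable_EFinP; exact: measurable_sqdist.
  - by move=> w _; rewrite lee_fin sqr_ge0.
pose S := ~` (K @^-1` [set +oo%E]).
have mS' : measurable (K @^-1` [set +oo%E]).
  by rewrite -[X in measurable X]setTI; apply: mK => //; exact: emeasurable_set1.
have mS : measurable S by exact: measurableC.
have lim w : exists l, S w ->
    (forall n, d (f n w) l ^+ 2 <= 4 / (2 ^+ n) ^+ 2 * fine (K w)) /\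
    forall x, (fun n => d x (f n w)) @ \oo --> d x l.
  have [Sw|nSw] := pselect (S w); last by exists point.
  have Kfin : K w \is a fin_num.
    by rewrite ge0_fin_numE// ltey; apply/eqP => Kw; apply: Sw.
  (* Each term of the series is at most [K w], so [2 ^+ n * d (f n w) (f n.+1 w)] is at most the
     square root of [K w]. *)
  have [|l [l1 l2]] := @geometric_cvg (fun n => f n w) _ (sqrtr_ge0 (fine (K w))).
    move=> n; rewrite ler_pdivlMr ?exprn_gt0//.
    rewrite -[leLHS]ger0_norm ?mulr_ge0 ?exprn_ge0 ?mdist_ge0//.
    rewrite -sqrtr_sqr; apply: ler_wsqrtr.
    rewrite exprMn mulrC -lee_fin fineK//.
    apply: le_trans (nneseries_lim_ge n.+1 _) => //.
    rewrite big_nat_recr//= leeDr//; exact: sume_ge0.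
  exists l => _; split => // n.
  rewrite [leRHS](_ : _ = (2 * Num.sqrt (fine (K w)) / 2 ^+ n) ^+ 2).
    apply: lerXn2r (l1 n); rewrite nnegrE ?mdist_ge0//.
  rewrite expr_div_n exprMn sqr_sqrtr; last exact: fine_ge0.
  by rewrite mulrAC; congr (_ * _ / _); ring.
have {lim}[g0 g0P] := choice lim.
pose g w := if pselect (S w) is left _ then g0 w else point.
have gS w : S w -> g w = g0 w by rewrite /g; case: pselect.
have gNS w : ~ S w -> g w = point by rewrite /g; case: pselect.
have mg : measurable_fun setT (g : O -> borel X).
  apply: measurable_to_borel => // x.
  rewrite (_ : setT = S `|` K @^-1` [set +oo%E]); last by rewrite setUC setUv.
  apply/measurable_funU => //; split.
    apply: (@measurable_fun_cvg _ _ _ S (fun n w => d x (f n w))) => //.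
      move=> n; apply: measurable_funTS.
      exact: measurableT_comp (measurable_mdistl x) (L2_measurable (f n)).
    by move=> w Sw; rewrite gS//; have [_] := g0P w Sw; exact.
  apply: (@eq_measurable_fun _ _ _ _ _ (cst (d x point))) => //.
  by move=> w; rewrite inE => Kw; rewrite gNS//; exact.
(* Off [S] the right-hand side is [+oo], so the bound holds at every point. *)
have fg n w : ((d (f n w) (g w) ^+ 2)%:E <= (4 / (2 ^+ n) ^+ 2)%:E * K w)%E.
  have [Sw|nSw] := pselect (S w).
    have Kfin : K w \is a fin_num.
      by rewrite ge0_fin_numE// ltey; apply/eqP => Kw; apply: Sw.
    by rewrite gS// -(fineK Kfin) -EFinM lee_fin; have [] := g0P w Sw.
  move/contrapT : nSw => /= ->.
  by rewrite gt0_muley ?leey// lte_fin divr_gt0 ?exprn_gt0.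
have mfg n : measurable_fun setT (fun w => (d (f n w) (g w) ^+ 2)%:E).
  apply/measurable_EFinP; apply: measurable_funX; apply: measurable_mdist2 => //.
  exact: L2_measurable.
have intfg n : (\int[P]_w (d (f n w) (g w) ^+ 2)%:E <= (8 * c / (2 ^+ n) ^+ 2)%:E)%E.
  apply: (@le_trans _ _ (\int[P]_w ((4 / (2 ^+ n) ^+ 2)%:E * K w))%E).
    apply: ge0_le_integral => //.
    - by move=> w _; rewrite lee_fin sqr_ge0.
    - by apply: measurable_funeM; exact: mK.
  rewrite ge0_integralZl//=.
  (* The 4 is the square of the factor 2 in [geometric_cvg], and [2 * c] bounds the integral of
     [K]. *)
  rewrite (_ : 8 * c / _ = 4 / (2 ^+ n) ^+ 2 * (2 * c)); last by ring.
  rewrite [leRHS]EFinM; apply: lee_pmul => //.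
  by apply: integral_ge0 => w _; exact: K0.
have gmom : (\int[P]_w (d point (g w) ^+ 2)%:E < +oo)%E.
  apply: (@integrable_lty _ _ _ P setT measurableT (fun w => (d point (g w) ^+ 2)%:E)).
  apply: (@le_integrable _ _ _ P setT measurableT _ (fun w =>
    2%:E * ((d (f 0%N w) (cstL2 P point w) ^+ 2)%:E + (d (f 0%N w) (g w) ^+ 2)%:E))%E).
  - apply/measurable_EFinP; apply: measurable_funX.
    exact: measurableT_comp (measurable_mdistl point) mg.
  - move=> w _ /=; rewrite lee_fin ger0_norm ?sqr_ge0// ger0_norm.
      exact: sqr_mdist_le.
    by rewrite mulr_ge0// addr_ge0// sqr_ge0.
  - apply: integrableZl => //; apply: integrableD => //.
      exact: integrable_sqdist.
    apply/integrableP; split => //.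
    rewrite (eq_integral (fun w => (d (f 0%N w) (g w) ^+ 2)%:E)).
      exact: le_lt_trans (intfg 0%N) (ltry _).
    by move=> w _; rewrite gee0_abs// lee_fin sqr_ge0.
exists (MkL2map mg gmom) => n.
by rewrite -lee_fin -sqdistE//; exact: intfg.
Qed.

End Completeness.

(** * Levy-Prokhorov comparison of measures *)

Section Prokhorov.
Context {R : realType} {X : completePMetricType R}.
Local Notation d := (@mdist R X).
Hypothesis sepX : separable X.

Definition thicken (F : set X) (e : R) : set X := [set y | exists2 x, F x & d x y < e].

Lemma open_thicken F e : open (thicken F e).
Proof.
apply: open_mdist => y [x Fx xy]; exists (e - d x y); first by rewrite subr_gt0.
move=> z yz; exists x => //; have := metric_triangle x y z; lra.
Qed.

Definition prokhorov_le (e : R) (mu nu : W2 X) : Prop :=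
  forall F : set (borel X), measurable F -> (mu F <= nu (thicken F e) + e%:E)%E.

(* Unlike bounds on [W], these compose without gluing couplings. *)
Lemma prokhorov_le_trans e1 e2 mu nu rho :
  prokhorov_le e1 mu nu -> prokhorov_le e2 nu rho -> prokhorov_le (e1 + e2) mu rho.
Proof.
move=> h1 h2 F mF; apply: le_trans (h1 _ mF) _.
rewrite [leRHS](_ : _ = rho (thicken F (e1 + e2)) + e2%:E + e1%:E)%E; last first.
  by rewrite -addeA -EFinD (addrC e2).
rewrite leeD2r//.
have mt e G : measurable (thicken G e : set (borel X)).
  by apply: measurable_openX; exact: open_thicken.
apply: le_trans (h2 _ (mt _ _)) _; rewrite leeD2r//.
apply: le_measure; rewrite ?inE; [exact: mt|exact: mt|].
move=> z [y [x Fx xy] yz]; exists x => //.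
by have := metric_triangle x y z; lra.
Qed.

(** A closed set is the intersection of its thickenings of radius [r n], and [nu] is continuous from
    above. *)
Lemma prokhorov_le_eq_closed mu nu : (forall e, 0 < e -> prokhorov_le e mu nu) ->
  forall F : set X, closed F -> (mu F <= nu F)%E.
Proof.
move=> h F cF.
have mF : measurable (F : set (borel X)).
  rewrite -(setCK F); apply: measurableC; apply: measurable_openX.
  exact: closed_openC.
pose r (n : nat) : R := n.+1%:R^-1.
have r0 n : 0 < r n by rewrite invr_gt0.
have mt e G : measurable (thicken G e : set (borel X)).
  by apply: measurable_openX; exact: open_thicken.
have FE : F = \bigcap_n thicken F (r n).
  apply/seteqP; split=> [x Fx n _|x hx]; first by exists x; rewrite ?mdistxx.
  rewrite (closure_id F).1// => A; rewrite -nbhs_ballE => -[e /= e0 eA].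
  have [n ne] : exists n, r n < e.
    near \oo => k; exists k.
    by near: k; apply: near_infty_natSinv_lt (PosNum e0).
  have [y Fy yx] := hx n I; exists y; split => //; apply: eA.
  by rewrite ballEmdist/= metric_sym; exact: lt_trans ne.
have c1 : nu (thicken F (r n)) @[n --> \oo] --> nu F.
  rewrite {2}FE; apply: nonincreasing_cvg_mu => //.
  - by rewrite ltey_eq fin_num_measure.
  - by rewrite -FE.
  - move=> m n mn; apply/subsetPset => y [x Fx xy]; exists x => //.
    by apply: lt_le_trans xy _; rewrite lef_pV2 ?posrE// ler_nat.
have c2 : (nu (thicken F (r n)) + (r n)%:E)%E @[n --> \oo] --> (nu F + 0)%E.
  apply: cvgeD => //; first by rewrite fin_num_adde_defl.
  apply: cvg_EFin; first exact: nearW.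
  exact: cvg_harmonic.
rewrite -[leRHS]adde0; have <- := cvg_lim _ c2; last by [].
apply: lime_ge; first by apply/cvg_ex; eexists; exact: c2.
by apply: nearW => n; apply: h.
Unshelve. all: by end_near. Qed.

Lemma prokhorov_le_eq mu nu :
  (forall e, 0 < e -> prokhorov_le e mu nu /\ prokhorov_le e nu mu) -> mu = nu.
Proof.
move=> h; apply: W2_ext => A mA.
apply: (measure_unique (@open X : set (set (borel X))) (fun=> setT)) => //.
- exact: openI.
- by move=> _; exact: openT.
- by rewrite bigcup_const.
- move=> U oU.
  have mU : measurable (U : set (borel X)) by exact: measurable_openX.
  have cU : closed (~` U) by exact: open_closedC.
  have e : mu (~` U) = nu (~` U).
    by apply/eqP; rewrite eq_le !prokhorov_le_eq_closed// => e /h[].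
  have pC (m : W2 X) : m U = (1 - m (~` U))%E.
    by rewrite -[U in LHS]setCK [LHS](probability_setC (W2_prob m))//; exact: measurableC.
  by rewrite [LHS]pC [RHS]pC e.
- by move=> _; rewrite [ltLHS](probability_setT (W2_prob mu)) ltry.
Qed.

(** Chebyshev's inequality: the exponent 3 is chosen so that the set where [d (f w) (g w)] is at
    least [e] has probability at most [e ^+ 3 / e ^+ 2 = e]. *)
Lemma prokhorov_le_sqdist dO (O : measurableType dO) (P : probability O R)
    (f g : L2map X P) e : 0 < e -> sqdist P f g <= e ^+ 3 ->
  prokhorov_le e (law f) (law g).
Proof.
move=> e0 Qe F mF.
have mt : measurable (thicken F e : set (borel X)).
  by apply: measurable_openX; exact: open_thicken.
have mpre (h : L2map X P) (A : set (borel X)) : measurable A -> measurable (h @^-1` A).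
  by move=> mA; rewrite -[X in measurable X]setTI; apply: L2_measurable.
pose E := [set w | e ^+ 2 <= d (f w) (g w) ^+ 2].
have mE : measurable E.
  rewrite -[E]setTI; apply: measurable_fun_le => //; exact: measurable_sqdist.
rewrite !lawE//.
apply: (@le_trans _ _ (P (g @^-1` thicken F e `|` E))).
  apply: le_measure; rewrite ?inE; [exact: mpre|by apply: measurableU => //; exact: mpre|].
  move=> w Fw; have [fg|fg] := ltP (d (f w) (g w)) e; [left|right].
    by exists (f w).
  by rewrite /E/= lerXn2r// nnegrE ?mdist_ge0// ltW.
apply: le_trans (measureU2 _ _ _) _ => //; first exact: mpre.
rewrite leeD2l//; suff : (P E <= e%:E)%E by [].
have : ((e ^+ 2)%:E * P E <= (sqdist P f g)%:E)%E.
  rewrite -sqdistE// -integral_cst//=.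
  apply: (@le_trans _ _ (\int[P]_(w in E) (d (f w) (g w) ^+ 2)%:E)%E).
    have mfg : measurable_fun E (fun w => (d (f w) (g w) ^+ 2)%:E).
      by apply: measurable_funTS; apply/measurable_EFinP; exact: measurable_sqdist.
    by apply: ge0_le_integral => // w _; rewrite ?lee_fin ?sqr_ge0.
  apply: ge0_subset_integral => //.
  - by apply/measurable_EFinP; exact: measurable_sqdist.
  - by move=> w _; rewrite lee_fin sqr_ge0.
rewrite -(@fineK _ (P E)) ?fin_num_measure// -EFinM !lee_fin => h.
have {}h := le_trans h Qe.
by rewrite -(ler_pM2l (exprn_gt0 2 e0)) -exprSr.
Qed.

End Prokhorov.

(** * Integer-valued maps and partitions of the unit interval *)

Section NatValued.
Context {R : realType}.

Lemma measurable_to_nat dO (O : measurableType dO) (a : O -> nat) :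
  (forall n, measurable (a @^-1` [set n])) -> measurable_fun setT a.
Proof.
move=> ma _ A _; rewrite setTI.
rewrite (_ : a @^-1` A = \bigcup_(n in A) (a @^-1` [set n])).
  exact: bigcup_measurable.
apply/seteqP; split=> w /=; first by move=> Aw; exists (a w).
by move=> [n An /= ->].
Qed.

Lemma measurable_of_nat dO (O : measurableType dO) dT (T : measurableType dT)
    (a : O -> nat) (h : nat -> T) :
  measurable_fun setT a -> measurable_fun setT (h \o a).
Proof. by move=> ma; apply: measurableT_comp ma => //. Qed.

Lemma integral_nat_eq dO (O : measurableType dO) (P : probability O R)
    dO' (O' : measurableType dO') (P' : probability O' R)
    (a : O -> nat) (a' : O' -> nat) (h : nat -> \bar R) :
  measurable_fun setT a -> measurable_fun setT a' ->
  (forall n, P (a @^-1` [set n]) = P' (a' @^-1` [set n])) ->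
  (forall n, 0 <= h n)%E ->
  (\int[P]_w h (a w) = \int[P']_w h (a' w))%E.
Proof.
have key dU (U : measurableType dU) (p : probability U R) (b : U -> nat) :
    measurable_fun setT b -> (forall n, 0 <= h n)%E ->
    (\int[p]_w h (b w) = \sum_(n <oo) h n * p (b @^-1` [set n]))%E.
  move=> mb h0.
  have mbn n : measurable (b @^-1` [set n]).
    by rewrite -[X in measurable X]setTI; exact: mb.
  have bU : \bigcup_n (b @^-1` [set n]) = setT.
    by apply/seteqP; split=> // w _; exists (b w).
  have := @ge0_integral_bigcup _ _ _ p (fun n => b @^-1` [set n]) (h \o b) mbn.
  rewrite /= bU => -> //.
  - apply: eq_eseriesr => n _.
    rewrite (eq_integral (cst (h n))); first by rewrite integral_cst.
    by move=> w; rewrite inE/= => ->.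
  - exact: measurable_of_nat.
  - apply/trivIsetP => i j _ _ /eqP ij; rewrite -subset0 => w /= [wi wj].
    by apply: ij; rewrite -wi -wj.
move=> ma ma' PP h0; rewrite !key//.
by apply: eq_eseriesr => n _; rewrite PP.
Qed.

Lemma integral_nat_eq2 dO (O : measurableType dO) (P : probability O R)
    dO' (O' : measurableType dO') (P' : probability O' R)
    (a b : O -> nat) (a' b' : O' -> nat) (h : nat -> nat -> \bar R) :
  measurable_fun setT a -> measurable_fun setT a' ->
  measurable_fun setT b -> measurable_fun setT b' ->
  (forall i j, P (a @^-1` [set i] `&` b @^-1` [set j]) =
               P' (a' @^-1` [set i] `&` b' @^-1` [set j])) ->
  (forall i j, 0 <= h i j)%E ->
  (\int[P]_w h (a w) (b w) = \int[P']_w h (a' w) (b' w))%E.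
Proof.
move=> ma ma' mb mb' PP h0.
(* Encoding the pair of indices as one integer reduces the claim to [integral_nat_eq]. *)
pose code (i j : nat) := pickle (i, j).
pose H n : \bar R := if (unpickle n : option (nat * nat)) is Some ij then h ij.1 ij.2 else 0%E.
have HE i j : h i j = H (code i j) by rewrite /H /code pickleK.
have pre V (u v : V -> nat) n : (fun w => code (u w) (v w)) @^-1` [set n] =
    if (unpickle n : option (nat * nat)) is Some ij then
      if code ij.1 ij.2 == n then u @^-1` [set ij.1] `&` v @^-1` [set ij.2]
      else set0 else set0.
  apply/seteqP; split=> w /=.
    by move=> <-; rewrite /code pickleK/= eqxx.
  case: unpickle => [[i j]|]//=; case: ifPn => // /eqP <- [-> ->] //.
have mcode dU (U : measurableType dU) (u v : U -> nat) :
    measurable_fun setT u -> measurable_fun setT v ->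
    measurable_fun setT (fun w => code (u w) (v w)).
  move=> mu mv; apply: measurable_to_nat => n; rewrite pre.
  case: unpickle => [[i j]|]//=; case: ifPn => // _.
  by apply: measurableI; rewrite -[X in measurable X]setTI; [exact: mu|exact: mv].
under eq_integral do rewrite HE.
under [RHS]eq_integral do rewrite HE.
apply: (@integral_nat_eq _ _ _ _ _ _ (fun w => code (a w) (b w))
  (fun w => code (a' w) (b' w))).
- exact: mcode.
- exact: mcode.
- move=> n; rewrite !pre; case: unpickle => [[i j]|]; last by rewrite !measure0.
  by rewrite /=; case: ifPn => // _; rewrite !measure0.
- by move=> n; rewrite /H; case: unpickle => [[i j]|].
Qed.

(** The null set left over by [unif_split] is added to the piece of index 0, which gives a true
    partition of [A]. *)
Lemma unif_partition (A : set (measurableTypeR R)) (p : nat -> R) :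
  measurable A -> (forall j, 0 <= p j) -> (\sum_(j <oo) (p j)%:E = unif A)%E ->
  exists B : nat -> set (measurableTypeR R), [/\ forall j, measurable (B j),
    trivIset setT B, \bigcup_j B j = A & forall j, unif (B j) = (p j)%:E].
Proof.
move=> mA p0 pA; have [B [mB tB BA PB]] := unif_split mA p0 pA.
pose N := A `\` \bigcup_j B j.
have mUB : measurable (\bigcup_j B j) by exact: bigcup_measurable.
have mN : measurable N by exact: measurableD.
have N0 : unif N = 0%E.
  have UBA : \bigcup_j B j `<=` A by move=> w [j _ /BA].
  rewrite /N measureD//; last by rewrite ltey_eq fin_num_measure.
  rewrite [X in (_ - X)%E](_ : _ = unif A); last first.
    rewrite (setIidr UBA) -pA [LHS]measure_semi_bigcup//.
    by apply: eq_eseriesr => n _; exact: PB.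
  by rewrite subee// fin_num_measure.
exists (fun j => B j `|` (if j == 0%N then N else set0)); split.
- by move=> j; apply: measurableU => //; case: ifP.
- apply/trivIsetP => i j _ _ ij.
  have Bij : B i `&` B j = set0 by move/trivIsetP : tB; apply.
  rewrite -subset0 => w [[Bi|Ni] [Bj|Nj]].
  + by rewrite -Bij.
  + by move: Nj; case: ifP => // _ [_ ]; apply; exists i.
  + by move: Ni; case: ifP => // _ [_ ]; apply; exists j.
  + move: Ni; case: eqP => [i0 _|//]; move: Nj; case: eqP => [j0 _|//].
    by rewrite i0 j0 in ij.
- apply/seteqP; split=> w.
    by move=> [j _ [/BA//|]]; case: ifP => // _ [].
  move=> Aw; have [Bw|nBw] := pselect ((\bigcup_j B j) w).
    by have [j _ Bj] := Bw; exists j => //; left.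
  by exists 0%N => //; right.
- move=> j; rewrite measureU//=.
  + by rewrite PB; case: ifP => _; rewrite ?N0 ?measure0 adde0.
  + by case: ifP.
  + rewrite -subset0 => w [Bw]; case: ifP => // _ [_]; apply.
    by exists j.
Qed.

End NatValued.

(** * Lifting pairs of maps to the unit interval *)

Section Lift.
Context {R : realType} {X : completePMetricType R}.
Local Notation d := (@mdist R X).
Local Notation Om := (measurableTypeR R).
Hypothesis sepX : separable X.

Definition compL2 dO (O : measurableType dO) (P : probability O R) (p : X -> X) (A K : R)
    (mp : measurable_fun setT (p : borel X -> borel X))
    (pAK : forall y, d point (p y) <= A + K * d point y) (f : L2map X P) : L2map X P :=
  MkL2map (comp_measurable f mp) (comp_moment sepX f mp pAK).

Lemma sqdist_le dO (O : measurableType dO) (P : probability O R) (f g : L2map X P) e :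
  (forall w, d (f w) (g w) <= e) -> sqdist P f g <= e ^+ 2.
Proof.
move=> fge.
have -> : e ^+ 2 = \int[P]_w (cst (e ^+ 2) w).
  by rewrite Rintegral_cst// [X in fine X](probability_setT P) mulr1.
apply: le_Rintegral => //.
- exact: integrable_sqdist.
- exact: finite_measure_integrable_cst.
- move=> w _ /=; apply: lerXn2r (fge w); rewrite nnegrE ?mdist_ge0//.
  exact: le_trans (mdist_ge0 _ _) (fge w).
Qed.

(** Taking for [J y] the least index of a dense sequence that is [e]-close to [y] makes each level
    set a ball minus finitely many balls, hence Borel. *)
Lemma discretization (e : R) : 0 < e -> exists (J : X -> nat) (q : nat -> X),
  measurable_fun setT (J : borel X -> nat) /\ forall y, d (q (J y)) y < e.
Proof.
move=> e0; have [q qd] := dense_seq sepX.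
have ex y : exists n, d (q n) y < e by exact: qd.
exists (fun y => ex_minn (ex y)), q; split; last by move=> y; case: ex_minnP.
apply: measurable_to_nat => n.
have mball m : measurable ([set y | d (q m) y < e] : set (borel X)).
  rewrite -[X in measurable X]setTI; apply: measurable_fun_ltr => //.
  exact: measurable_mdistl.
rewrite (_ : _ @^-1` _ = [set y | d (q n) y < e] `&`
    \bigcap_(m in [set m | (m < n)%N]) ~` [set y | d (q m) y < e]).
  apply: measurableI => //; apply: bigcap_measurableType => m _; exact: measurableC.
apply/seteqP; split=> y /=.
  case: ex_minnP => m me mn <-; split => // k km ke.
  by have := mn _ ke; rewrite leqNgt km.
move=> [ne nk]; case: ex_minnP => m me mn.
apply/eqP; rewrite eqn_leq mn//= leqNgt; apply/negP => mn'.
exact: nk _ mn' me.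
Qed.

Section Step.
Context {dO} {O : measurableType dO} (P : probability O R).
Variables (J : X -> nat) (q : nat -> X) (e : R).
Hypothesis mJ : measurable_fun setT (J : borel X -> nat).
Hypothesis qJ : forall y, d (q (J y)) y < e.

Lemma discL2_subproof y : d point (q (J y)) <= e + 1 * d point y.
Proof.
have := metric_triangle point y (q (J y)); rewrite (metric_sym y).
by have := qJ y; lra.
Qed.

Definition discL2 dU (U : measurableType dU) (p : probability U R) (f : L2map X p) :=
  compL2 (measurable_of_nat (T := borel X) q mJ) discL2_subproof f.

Lemma sqdist_disc dU (U : measurableType dU) (p : probability U R) (f : L2map X p) :
  Num.sqrt (sqdist p f (discL2 f)) <= e.
Proof.
have e0 : 0 < e := le_lt_trans (mdist_ge0 _ _) (qJ point).
rewrite -[leRHS]ger0_norm ?(ltW e0)// -sqrtr_sqr; apply: ler_wsqrtr.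
by apply: sqdist_le => w; rewrite metric_sym ltW//; exact: qJ.
Qed.

(* The law of [(f', g')] on the cells of the partition by [J] is reproduced by
   splitting each set [J \o f = i] in proportion to the masses of [J \o f' = i, J \o g' = j]. *)
Lemma approx_lift (f : L2map X unif) (f' g' : L2map X P) : law f = law f' ->
  exists g : L2map X unif, law g = law (discL2 g') /\
    Num.sqrt (sqdist unif f g) <= Num.sqrt (sqdist P f' g') + 3 * e.
Proof.
move=> ff'.
have mJh dU (U : measurableType dU) (p : probability U R) (h : L2map X p) :
    measurable_fun setT (J \o h).
  exact: measurableT_comp mJ (L2_measurable h).
have mset dU (U : measurableType dU) (u : U -> nat) n : measurable_fun setT u ->
    measurable (u @^-1` [set n]).
  by move=> mu; rewrite -[X in measurable X]setTI; exact: mu.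
pose A i j := (J \o f') @^-1` [set i] `&` (J \o g') @^-1` [set j].
have mA i j : measurable (A i j) by apply: measurableI; exact: mset.
pose Oi i := (J \o f) @^-1` [set i].
have partB i : exists B : nat -> set Om, [/\ forall j, measurable (B j),
    trivIset setT B, \bigcup_j B j = Oi i & forall j, unif (B j) = P (A i j)].
  have [] := @unif_partition R (Oi i) (fun j => fine (P (A i j))).
  - exact: mset.
  - by move=> j; rewrite fine_ge0.
  (* For fixed [i] the masses of the cells add up to that of [J \o f' = i], which is that of
     [J \o f = i] because [f] and [f'] have the same law. *)
  - transitivity (\sum_(j <oo) P (A i j))%E.
      by apply: eq_eseriesr => j _; rewrite fineK// fin_num_measure.
    rewrite -measure_semi_bigcup//.
    + rewrite -setI_bigcupr (_ : \bigcup_j _ = setT); last first.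
        by apply/seteqP; split => // w _; exists (J (g' w)).
      have mJi : measurable (J @^-1` [set i] : set (borel X)) by exact: mset.
      rewrite setIT; transitivity (law f' (J @^-1` [set i])); first by rewrite lawE.
      by rewrite -ff' lawE.
    + apply/trivIsetP => j k _ _ /eqP jk; rewrite -subset0 => w /= [[_ wj] [_ wk]].
      by apply: jk; rewrite -wj -wk.
    + by apply: bigcup_measurable => j _.
  move=> B [mB tB BO PB]; exists B; split => // j.
  by rewrite PB fineK// fin_num_measure.
have [B BP] := choice partB.
have mB i j : measurable (B i j) by have [] := BP i.
have PB i j : unif (B i j) = P (A i j) by have [] := BP i.
pose k (w : Om) : nat := get [set j | B (J (f w)) j w].
have Bk w : B (J (f w)) (k w) w.
  apply: (@getPex _ [set j | B (J (f w)) j w]).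
  have [_ _ BO _] := BP (J (f w)).
  have : (\bigcup_j B (J (f w)) j) w by rewrite BO.
  by move=> [j _ Bj]; exists j.
have BE i j w : B i j w <-> J (f w) = i /\ k w = j.
  split=> [Bij|[<- <-]//].
  have [_ tB BO _] := BP i.
  have wi : J (f w) = i.
    by have : (\bigcup_j B i j) w by [exists j]; rewrite BO.
  split => //; apply: (tB _ _ I I); exists w; split => //.
  by rewrite -wi; exact: Bk.
have mk : measurable_fun setT k.
  apply: measurable_to_nat => j.
  rewrite (_ : k @^-1` [set j] = \bigcup_i B i j); first exact: bigcup_measurable.
  apply/seteqP; split => w /=; first by move=> <-; exists (J (f w)).
  by move=> [i _ /BE[]].
have PP i j : unif ((J \o f) @^-1` [set i] `&` k @^-1` [set j]) =
    P ((J \o f') @^-1` [set i] `&` (J \o g') @^-1` [set j]).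
  rewrite -PB; congr (unif _); apply/seteqP; split => w /=.
    by move=> [wi wj]; apply/BE.
  by move=> /BE.
have int_eq (h : nat -> nat -> \bar R) : (forall i j, 0 <= h i j)%E ->
    (\int[unif]_w h (J (f w)) (k w) = \int[P]_w h (J (f' w)) (J (g' w)))%E.
  by move=> h0; apply: (integral_nat_eq2 (a := J \o f) (a' := J \o f')
    (b := k) (b' := J \o g')) => //; exact: mJh.
pose g (w : Om) : X := q (k w).
have mg : measurable_fun setT (g : Om -> borel X) := measurable_of_nat (T := borel X) q mk.
have gm : (\int[unif]_w (d point (g w) ^+ 2)%:E < +oo)%E.
  rewrite (int_eq (fun _ j => (d point (q j) ^+ 2)%:E)).
    exact: (L2_moment (discL2 g')).
  by move=> i j; rewrite lee_fin sqr_ge0.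
pose G : L2map X unif := MkL2map mg gm.
(* The distance between discretized maps depends only on the joint law of their indices, which [PP]
   transfers. *)
have GE : sqdist unif (discL2 f) G = sqdist P (discL2 f') (discL2 g').
  apply: EFin_inj; rewrite -!sqdistE//.
  apply: (int_eq (fun i j => (d (q i) (q j) ^+ 2)%:E)).
  by move=> i j; rewrite lee_fin sqr_ge0.
exists G; split.
  apply: W2_ext => C mC; rewrite !lawE//.
  have mGC : measurable (G @^-1` C) by rewrite -[X in measurable X]setTI; exact: L2_measurable.
  have mgC : measurable (discL2 g' @^-1` C).
    by rewrite -[X in measurable X]setTI; exact: L2_measurable.
  have ind dU (U : measurableType dU) (p : probability U R) (E : set U) :
      measurable E -> p E = (\int[p]_w (\1_E w)%:E)%E.
    by move=> mE; rewrite integral_indic// setIT.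
  rewrite !ind//.
  exact: (int_eq (fun _ j => (\1_C (q j))%:E)).
(* Each of [f], [f'] and [g'] is exchanged once with its discretization, whence [3 * e]. *)
apply: le_trans (sqdist_triangle sepX f (discL2 f) G) _.
rewrite GE; have := sqdist_triangle sepX (discL2 f') f' (discL2 g').
have := sqdist_triangle sepX f' g' (discL2 g').
have := sqdist_disc f; have := sqdist_disc f'; have := sqdist_disc g'.
rewrite (sqdist_sym P (discL2 f') f'); lra.
Qed.

End Step.

Lemma L2_lift dO (O : measurableType dO) (P : probability O R)
    (f : L2map X unif) (f' g' : L2map X P) (e : R) : 0 < e -> law f = law f' ->
  exists g : L2map X unif, law g = law g' /\
    Num.sqrt (sqdist unif f g) <= Num.sqrt (sqdist P f' g') + e.
Proof.
move=> e0 ff'.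
(* The denominator 15 is 3 + 12: the first approximation costs [3 * r 0], with [r 0 = e / 15], and
   the passage to the limit at most [12 * (e / 15)]. *)
pose r n : R := e / 15 / (2 ^+ n) ^+ 2.
have r0 n : 0 < r n by rewrite !divr_gt0// exprn_gt0// exprn_gt0.
have [J] := choice (fun n => discretization (r0 n)).
move=> /choice[q Jq].
pose D n (h : L2map X P) := discL2 (proj1 (Jq n)) (proj2 (Jq n)) h.
have [g0 [g0E g0d]] := approx_lift (proj1 (Jq 0%N)) (proj2 (Jq 0%N)) g' ff'.
(* [approx_lift] is applied to [D n g'] and [g'], which are at most [r n] apart. The condition on
   the law stands under the existential so that [choice] gives a total step function. *)
have stepP (nh : nat * L2map X unif) : exists h : L2map X unif,
    law nh.2 = law (D nh.1 g') -> law h = law (D nh.1.+1 g') /\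
    Num.sqrt (sqdist unif nh.2 h) <= r nh.1 + 3 * r nh.1.+1.
  have [hE|] := pselect (law nh.2 = law (D nh.1 g')); last by exists nh.2.
  have [h [h1 h2]] := approx_lift (proj1 (Jq nh.1.+1)) (proj2 (Jq nh.1.+1)) g' hE.
  exists h => _; split => //; apply: le_trans h2 _; rewrite lerD2r sqdist_sym.
  exact: sqdist_disc.
have [s sP] := choice stepP.
pose G := nat_rect (fun=> L2map X unif) g0 (fun n h => s (n, h)).
have GE n : law (G n) = law (D n g').
  elim: n => [//|n IH]; by have [] := sP (n, G n) IH.
have Gd n : Num.sqrt (sqdist unif (G n) (G n.+1)) <= r n + 3 * r n.+1.
  by have [] := sP (n, G n) (GE n).
(* Consecutive maps are at most [4 * r n] apart. The square of this is [16 * (e / 15) ^+ 2] divided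
   by the n-th power of 16, where a division by the n-th power of 8 is enough. *)
have [||g gP] := L2_geometric_cvg sepX (f := G) (c := 16 * (e / 15) ^+ 2).
- by rewrite mulr_ge0// sqr_ge0.
- move=> n.
  have rS : r n.+1 = r n / 4.
    have : (2 : R) ^+ n != 0 by rewrite expf_neq0.
    by rewrite /r (exprS _ n); move: ((2 : R) ^+ n) => t t0; field.
  have h : Num.sqrt (sqdist unif (G n) (G n.+1)) <= 4 * r n.
    by apply: le_trans (Gd n) _; rewrite rS; have := r0 n; lra.
  rewrite -(@sqr_sqrtr _ (sqdist _ _ _)) ?sqdist_ge0//.
  apply: (@le_trans _ _ ((4 * r n) ^+ 2)).
    by apply: lerXn2r h; rewrite nnegrE ?sqrtr_ge0// mulr_ge0// ltW.
  have q1 : 1 <= (2 : R) ^+ n by apply: exprn_ege1; lra.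
  rewrite /r; move: ((2 : R) ^+ n) q1 => t t1.
  rewrite (_ : (4 * (e / 15 / t ^+ 2)) ^+ 2 = 16 * (e / 15) ^+ 2 / t / t ^+ 2 / t); last first.
    by field; rewrite gt_eqF//; lra.
  rewrite ler_pdivrMr; last by lra.
  rewrite ler_peMr// !divr_ge0 ?mulr_ge0 ?sqr_ge0//; lra.
have sq_small (c : R) : 0 <= c -> forall a, 0 < a -> exists n, c / (2 ^+ n) ^+ 2 <= a.
  move=> c0 a a0; have [n na] := geometric_small c a0; exists n.
  apply: ltW; apply: le_lt_trans na; rewrite ler_wpM2l//.
  rewrite lef_pV2 ?posrE ?exprn_gt0// ler_eXnr//.
  by apply: exprn_ege1; lra.
have c0 : 0 <= 16 * (e / 15) ^+ 2 by rewrite mulr_ge0// sqr_ge0.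
exists g; split.
  (* [G n] tends to [g] and [D n g'] to [g'], with equal laws at each stage, so two comparisons at
     scale [b] compose into one at scale [a]. *)
  apply: prokhorov_le_eq => // a a0.
  pose b := a / 2; have b0 : 0 < b by rewrite divr_gt0.
  have b3 : 0 < b ^+ 3 by rewrite exprn_gt0.
  have [|n nb] := sq_small (8 * (16 * (e / 15) ^+ 2) + (e / 15) ^+ 2) _ _ b3.
    by rewrite addr_ge0 ?sqr_ge0// mulr_ge0.
  have q1 : 1 <= ((2 : R) ^+ n) ^+ 2 by do 2 apply: exprn_ege1; lra.
  have h1 : sqdist unif (G n) g <= b ^+ 3.
    apply: le_trans (gP n) _; apply: le_trans nb.
    by rewrite ler_pM2r ?invr_gt0 ?exprn_gt0// lerDl sqr_ge0.
  have h2 : sqdist P g' (D n g') <= b ^+ 3.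
    apply: (@le_trans _ _ ((r n) ^+ 2)).
      by apply: sqdist_le => w; rewrite metric_sym ltW//; exact: (proj2 (Jq n)).
    apply: le_trans nb; rewrite /r; move: (((2 : R) ^+ n) ^+ 2) q1 => t t1.
    rewrite expr_div_n expr2; apply: (@le_trans _ _ ((e / 15) ^+ 2 / t)).
      rewrite ler_wpM2l ?sqr_ge0// lef_pV2 ?posrE ?mulr_gt0; nra.
    by rewrite ler_pM2r ?invr_gt0; [rewrite lerDr mulr_ge0|lra].
  rewrite (_ : a = b + b); last by rewrite /b -splitr.
  split; apply: prokhorov_le_trans.
  - by apply: prokhorov_le_sqdist b0 _; rewrite // sqdist_sym; exact: h1.
  - by rewrite GE; apply: prokhorov_le_sqdist b0 _; rewrite // sqdist_sym.
  - exact: prokhorov_le_sqdist b0 h2.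
  - by rewrite -GE; apply: prokhorov_le_sqdist b0 _.
have g0g : Num.sqrt (sqdist unif g0 g) <= 12 * (e / 15).
  rewrite -[leRHS]ger0_norm; last by rewrite mulr_ge0// divr_ge0// ltW.
  rewrite -sqrtr_sqr; apply: ler_wsqrtr; apply: le_trans (gP 0%N) _.
  rewrite expr0 expr1n divr1; have := sqr_ge0 (e / 15); lra.
apply: le_trans (sqdist_triangle sepX f g0 g) _.
have := g0d; rewrite /r expr0 expr1n divr1; lra.
Qed.

End Lift.

(** * The Wasserstein metric *)

Section Metric.
Context {R : realType} {X : completePMetricType R}.
Local Notation d := (@mdist R X).
Local Notation Om := (measurableTypeR R).
Local Notation M := (L2map X (@unif R)).
Local Notation D f g := (Num.sqrt (sqdist (@unif R) f g)).
Hypothesis sepX : separable X.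
Implicit Types (mu nu rho : W2 X) (f g : M).

Lemma law_cstL2 dO (O : measurableType dO) (P : probability O R) (x : X) :
  law (cstL2 P x) = delta x.
Proof.
apply: W2_ext => A mA; rewrite lawE//= /borel_dirac asboolT// diracE.
rewrite (_ : _ @^-1` _ = if x \in A then setT else set0).
  by case: ifP => _; rewrite ?probability_setT ?measure0.
case: ifPn => [|]; first by rewrite inE => xA; apply/seteqP; split.
by rewrite notin_setE => xA; apply/seteqP; split.
Qed.

(** The constant maps on the unit interval and on the space of [mu] share the law [delta point];
    lifting the identity of [mu] from there transports it to the unit interval. *)
Lemma law_surj mu : exists f : M, law f = mu.
Proof.
have e : law (cstL2 unif (point : X)) = law (cstL2 (W2_prob mu) (point : X)) by rewrite !law_cstL2.
have [g [gE _]] := L2_lift sepX (idL2 mu) ltr01 e.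
by exists g; rewrite gE law_idL2.
Qed.

Lemma W_lift f nu (a : R) : W (law f) nu < a -> exists g, law g = nu /\ D f g < a.
Proof.
move=> Wa; have [g0 g0E] := law_surj nu.
have [|pi [f' [g' [f'E g'E fga]]]] := W_lt sepX (mu := law f) (nu := nu) (a := a) _ Wa.
  by have [pi [cpi _]] := joint_law sepX f g0; exists pi; rewrite -g0E.
pose e := (a - Num.sqrt (sqdist pi f' g')) / 2.
have e0 : 0 < e by rewrite divr_gt0// subr_gt0.
have [g [gE gd]] := L2_lift sepX g' e0 (esym f'E).
exists g; rewrite gE; split => //; apply: le_lt_trans gd _.
by rewrite /e; lra.
Qed.

Lemma W_sym mu nu : W mu nu = W nu mu.
Proof.
suff h (m n : W2 X) : W m n <= W n m by apply/eqP; rewrite eq_le !h.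
have [f <-] := law_surj n.
apply/ler_addgt0Pr => e e0.
have [|g [<- fg]] := @W_lift f m (W (law f) m + e); first by rewrite ltrDl.
by apply: le_trans (W_le sepX g f) _; rewrite sqdist_sym ltW.
Qed.

Lemma W_triangle nu mu rho : W mu rho <= W mu nu + W nu rho.
Proof.
apply/ler_addgt0Pr => e e0; have e2 : 0 < e / 2 by rewrite divr_gt0.
have [f <-] := law_surj mu.
have [|g [<- fg]] := @W_lift f nu (W (law f) nu + e / 2); first by rewrite ltrDl.
have [|h [<- gh]] := @W_lift g rho (W (law g) rho + e / 2); first by rewrite ltrDl.
apply: le_trans (W_le sepX f h) _; apply: le_trans (sqdist_triangle sepX f g h) _.
by move: fg gh; rewrite -/(W _ _); lra.
Qed.

Lemma Wxx mu : W mu mu = 0.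
Proof.
have [f <-] := law_surj mu; apply/eqP; rewrite eq_le W_ge0 andbT.
by have := W_le sepX f f; rewrite sqdistxx sqrtr0.
Qed.

Lemma W_eq0 mu nu : W mu nu = 0 -> mu = nu.
Proof.
move=> W0; have [f fE] := law_surj mu.
apply: prokhorov_le_eq => // e e0.
have s0 : 0 < Num.sqrt (e ^+ 3) by rewrite sqrtr_gt0 exprn_gt0.
have [|g [gE fg]] := @W_lift f nu (Num.sqrt (e ^+ 3)); first by rewrite fE W0.
have {}fg : sqdist unif f g <= e ^+ 3.
  by move: fg; rewrite ltr_sqrt ?exprn_gt0// => /ltW.
by rewrite -fE -gE; split; apply: prokhorov_le_sqdist => //; rewrite sqdist_sym.
Qed.

(** All maps with the law of [f] are at the same L2 distance from a constant map, since the square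
    of this distance is the integral of [d x y ^+ 2] against the law. *)
Lemma W_delta (x : X) f : W (delta x) (law f) = D (cstL2 unif x) f.
Proof.
apply/eqP; rewrite eq_le -(law_cstL2 unif) W_le//=.
apply/ler_addgt0Pr => e e0.
have [|g [gE fg]] := @W_lift (cstL2 unif x) (law f) (W (law (cstL2 unif x)) (law f) + e).
  by rewrite ltrDl.
apply: le_trans (ltW fg); rewrite le_eqVlt; apply/orP; left; apply/eqP; congr Num.sqrt.
apply: EFin_inj; rewrite -(sqdistE sepX (cstL2 unif x) f) -(sqdistE sepX (cstL2 unif x) g).
have mx : measurable_fun setT (fun y : borel X => (d x y ^+ 2)%:E).
  by apply/measurable_EFinP; apply: measurable_funX; exact: measurable_mdistl.
have x0 y : (0 <= (d x y ^+ 2)%:E)%E by rewrite lee_fin sqr_ge0.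
by rewrite -(integral_law f mx x0) -(integral_law g mx x0) gE.
Qed.

(** Each measure is lifted from the previous lift, which gives an L2 Cauchy sequence. The 1 in
    [c + 1] leaves room for the strict inequality of [W_lift], and 3 bounds the square root of the 8
    of [L2_geometric_cvg]. *)
Lemma W2_geometric_cvg (mu : nat -> W2 X) (c : R) : 0 <= c ->
  (forall n, W (mu n) (mu n.+1) <= c / (2 ^+ n) ^+ 2) ->
  exists l, forall n, W (mu n) l <= 3 * (c + 1) / 2 ^+ n.
Proof.
move=> c0 muc.
have [f0 f0E] := law_surj (mu 0%N).
have q1 n : 1 <= (2 : R) ^+ n by apply: exprn_ege1; lra.
have q0 n : 0 < (2 : R) ^+ n := lt_le_trans ltr01 (q1 n).
have stepP (nf : nat * M) : exists g : M, law nf.2 = mu nf.1 ->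
    law g = mu nf.1.+1 /\ D nf.2 g < (c + 1) / (2 ^+ nf.1) ^+ 2.
  have [fE|] := pselect (law nf.2 = mu nf.1); last by exists f0.
  have [|g [gE gd]] := @W_lift nf.2 (mu nf.1.+1) ((c + 1) / (2 ^+ nf.1) ^+ 2).
    by rewrite fE; apply: le_lt_trans (muc _) _; rewrite ltr_pM2r ?ltrDl// invr_gt0 exprn_gt0.
  by exists g.
have [s sP] := choice stepP.
pose G := nat_rect (fun=> M) f0 (fun n h => s (n, h)).
have GE n : law (G n) = mu n.
  by elim: n => [//|n IH]; have [] := sP (n, G n) IH.
have Gd n : D (G n) (G n.+1) < (c + 1) / (2 ^+ n) ^+ 2.
  by have [] := sP (n, G n) (GE n).
have [||g gP] := L2_geometric_cvg sepX (f := G) (c := (c + 1) ^+ 2).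
- exact: sqr_ge0.
- move=> n; rewrite -(@sqr_sqrtr _ (sqdist _ _ _)) ?sqdist_ge0//.
  apply: (@le_trans _ _ (((c + 1) / (2 ^+ n) ^+ 2) ^+ 2)).
    apply: lerXn2r (ltW (Gd n)); rewrite nnegrE ?sqrtr_ge0// divr_ge0 ?exprn_ge0//; lra.
  have := q1 n; move: ((2 : R) ^+ n) => t t1.
  rewrite (_ : ((c + 1) / t ^+ 2) ^+ 2 = (c + 1) ^+ 2 / t / t ^+ 2 / t); last first.
    by field; rewrite gt_eqF//; lra.
  rewrite ler_pdivrMr; last by lra.
  by rewrite ler_peMr// !divr_ge0 ?sqr_ge0//; lra.
exists (law g) => n; rewrite -GE; apply: le_trans (W_le sepX (G n) g) _.
rewrite -[leRHS]ger0_norm; last by rewrite divr_ge0 ?ltW//; lra.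
rewrite -sqrtr_sqr; apply: ler_wsqrtr; apply: le_trans (gP n) _.
rewrite expr_div_n ler_pM2r ?invr_gt0 ?exprn_gt0// exprMn.
by have := sqr_ge0 (c + 1); lra.
Qed.

End Metric.

(** * Homotheties of a CAT(0) space, and of its Wasserstein space *)

Section Cat0.
Context {R : realType} {X : completePMetricType R}.
Local Notation d := (@mdist R X).
Hypothesis geoX : geodesic_space X.
Hypothesis catX : CAT0 X.

Definition plane_point (u v : R) : 'rV[R]_2 := \row_i if i == ord0 then u else v.

Lemma euclidean_distE (p q : 'rV[R]_2) : euclidean_dist p q =
  Num.sqrt ((p 0 0 - q 0 0) ^+ 2 + (p 0 1 - q 0 1) ^+ 2).
Proof. by rewrite /euclidean_dist 2!big_ord_recl big_ord0 addr0; do 6 f_equal; apply/val_inj. Qed.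

(** The vertices are 0, [(a, 0)] and [(u, v)], with [u] given by the law of cosines. The last clause
    is that law for points of the two sides issuing from 0; it turns the CAT(0) comparison into
    algebra. *)
Lemma comparison_triangle (a b c : R) : 0 <= a -> 0 <= b -> 0 <= c ->
  a <= b + c -> b <= a + c -> c <= a + b -> exists q r : 'rV[R]_2,
  [/\ euclidean_dist 0 q = a, euclidean_dist 0 r = b, euclidean_dist q r = c &
    forall s t : R, euclidean_dist (s *: q) (t *: r) ^+ 2 =
      s ^+ 2 * a ^+ 2 + t ^+ 2 * b ^+ 2 - s * t * (a ^+ 2 + b ^+ 2 - c ^+ 2)].
Proof.
move=> a0 b0 c0 abc bac cab.
suff [u [v [u1 u2]]] : exists u v : R, a * u *+ 2 = a ^+ 2 + b ^+ 2 - c ^+ 2 /\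
    u ^+ 2 + v ^+ 2 = b ^+ 2.
  exists (plane_point a 0), (plane_point u v).
  have E s t : euclidean_dist (s *: plane_point a 0) (t *: plane_point u v) ^+ 2 =
      s ^+ 2 * a ^+ 2 + t ^+ 2 * b ^+ 2 - s * t * (a ^+ 2 + b ^+ 2 - c ^+ 2).
    rewrite euclidean_distE sqr_sqrtr ?addr_ge0 ?sqr_ge0// !mxE/= -u1 -u2.
    by ring.
  have sqE (p q : 'rV[R]_2) k : 0 <= k -> euclidean_dist p q ^+ 2 = k ^+ 2 ->
      euclidean_dist p q = k.
    by move=> k0 e; apply/eqP; rewrite -(@eqrXn2 _ 2) ?e// sqrtr_ge0.
  split => //; apply: sqE => //.
  - rewrite euclidean_distE sqr_sqrtr ?addr_ge0 ?sqr_ge0// !mxE/=; ring.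
  - rewrite euclidean_distE sqr_sqrtr ?addr_ge0 ?sqr_ge0// !mxE/= -u2; ring.
  - by have := E 1 1; rewrite !scale1r => ->; ring.
have [a00|a_neq0] := eqVneq a 0.
  have bc : b = c by lra.
  by exists b, 0; split; rewrite ?a00 bc; ring.
have a_gt0 : 0 < a by rewrite lt_neqAle eq_sym a_neq0.
pose u := (a ^+ 2 + b ^+ 2 - c ^+ 2) / (2 * a).
have uE : a * u *+ 2 = a ^+ 2 + b ^+ 2 - c ^+ 2.
  by rewrite /u; field.
exists u, (Num.sqrt (b ^+ 2 - u ^+ 2)); split => //.
rewrite sqr_sqrtr; first by ring.
(* The triangle inequalities amount to [|u| <= b], so that the square root above is a genuine
   one. *)
have h1 : 0 <= (b - u) * a by nra.
have h2 : 0 <= (b + u) * a by nra.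
rewrite pmulr_lge0// in h1; rewrite pmulr_lge0// in h2.
by rewrite subr_sqr mulr_ge0.
Qed.

Definition homothety (p : X) (a : R) (y : X) : X :=
  get [set g : R -> X | [/\ geodesic d `[0, 1] g, g 0 = p & g 1 = y]] a.

Lemma homothetyP p y : [/\ geodesic d `[0, 1] (homothety p ^~ y),
  homothety p 0 y = p & homothety p 1 y = y].
Proof.
have [g gP] := geoX p y.
exact: (@getPex _ [set g : R -> X | [/\ geodesic d `[0, 1] g, g 0 = p & g 1 = y]]
  (ex_intro _ g gP)).
Qed.

Lemma homothety_dist p y (a b : R) : 0 <= a <= 1 -> 0 <= b <= 1 ->
  d (homothety p a y) (homothety p b y) = `|a - b| * d p y.
Proof.
move=> a01 b01; have [[v v0 g] h0 h1] := homothetyP p y.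
have -> : d p y = v.
  by rewrite -{1}h0 -{2}h1 g ?in_itv/= ?lexx ?ler01// sub0r normrN1 mulr1.
by rewrite g ?in_itv// mulrC.
Qed.

(** Once squared, the comparison is linear in the squared distances. Contraction is the case [a = b]
    and CN the case [a = 1]. *)
Lemma homothety_cat0 p y z (a b : R) : 0 <= a <= 1 -> 0 <= b <= 1 ->
  d (homothety p a y) (homothety p b z) ^+ 2 <= a ^+ 2 * d p y ^+ 2 +
  b ^+ 2 * d p z ^+ 2 - a * b * (d p y ^+ 2 + d p z ^+ 2 - d y z ^+ 2).
Proof.
move=> a01 b01.
have [||||||q [r [pq pr qr E]]] := @comparison_triangle (d p y) (d p z) (d y z).
- exact: mdist_ge0.
- exact: mdist_ge0.
- exact: mdist_ge0.
- by have := metric_triangle p z y; rewrite (metric_sym z y).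
- exact: metric_triangle.
- by have := metric_triangle y p z; rewrite (metric_sym y p).
have := catX (homothetyP p y) (homothetyP p z) (And3 pq pr qr) a01 b01.
rewrite !scaler0 !add0r => h; rewrite -E.
by apply: lerXn2r h; rewrite nnegrE ?mdist_ge0 ?sqrtr_ge0.
Qed.

Lemma homothety_contraction p y z (a : R) : 0 <= a <= 1 ->
  d (homothety p a y) (homothety p a z) <= a * d y z.
Proof.
move=> a01; have /andP[a0 a1] := a01.
rewrite -(@ler_pXn2r _ 2) ?nnegrE ?mulr_ge0 ?mdist_ge0//.
apply: le_trans (homothety_cat0 _ _ _ a01 a01) _; rewrite exprMn; lra.
Qed.

(* CN refers to the inequality of Bruhat and Tits. *)
Lemma homothety_CN p y z (b : R) : 0 <= b <= 1 ->
  d y (homothety p b z) ^+ 2 <= (1 - b) * d p y ^+ 2 + b * d y z ^+ 2 -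
    b * (1 - b) * d p z ^+ 2.
Proof.
move=> b01; have [_ _ h1] := homothetyP p y.
rewrite -{1}h1; apply: le_trans (homothety_cat0 _ _ _ _ b01) _; last by lra.
by rewrite ler01 lexx.
Qed.

(* Eliminates [m], which will be a point of a geodesic between two further points,
   bounded through CN; its measurability in these points is thus not needed. *)
Lemma dist2_weighted (y m x : X) (k A B : R) : 0 < k ->
  d x m ^+ 2 <= A -> d y m ^+ 2 <= B ->
  d x y ^+ 2 <= (1 + k) * A + (1 + k^-1) * B.
Proof.
move=> k0 xm ym.
have xy : d x y <= d x m + d y m.
  by have := metric_triangle x m y; rewrite (metric_sym m y).
have h : d x y ^+ 2 <= (d x m + d y m) ^+ 2.
  by apply: lerXn2r xy; rewrite nnegrE ?addr_ge0 ?mdist_ge0.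
apply: le_trans h _.
have ki0 : 0 < k^-1 by rewrite invr_gt0.
apply: (@le_trans _ _ ((1 + k) * d x m ^+ 2 + (1 + k^-1) * d y m ^+ 2)); last first.
  by apply: lerD; rewrite ler_pM2l//; lra.
rewrite -subr_ge0.
rewrite (_ : _ - _ = (k * d x m - d y m) ^+ 2 / k); last first.
  by field; rewrite gt_eqF.
by rewrite divr_ge0 ?sqr_ge0// ltW.
Qed.

End Cat0.

(** * Homotheties of the Wasserstein space centred at a Dirac mass *)

Section Scale.
Context {R : realType} {X : completePMetricType R}.
Local Notation d := (@mdist R X).
Local Notation M := (L2map X (@unif R)).
Local Notation D f g := (Num.sqrt (sqdist (@unif R) f g)).
Local Notation N x mu := (W (delta x) mu).
Hypothesis hX : hadamard X.
Implicit Types (mu nu rho : W2 X) (f g : M) (x : X).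

Let sepX : separable X. Proof. by case: hX. Qed.
Let geoX : geodesic_space X. Proof. by case: hX. Qed.
Let catX : CAT0 X. Proof. by case: hX. Qed.

Lemma le_lim (A B C : R) : 0 <= C -> (forall e, 0 < e <= 1 -> A <= B + C * e) -> A <= B.
Proof.
move=> C0 h; apply/ler_addgt0Pr => e e0.
have C1 : 0 < C + 1 by lra.
pose t := Num.min 1 (e / (C + 1)).
have t0 : 0 < t by rewrite lt_min ltr01 divr_gt0.
apply: le_trans (h t _) _; first by rewrite t0 ge_min lexx.
rewrite lerD2l; apply: (@le_trans _ _ ((C + 1) * (e / (C + 1)))).
  by apply: ler_pM => //; [exact: ltW|lra|rewrite ge_min lexx orbT].
by rewrite mulrC divfK// gt_eqF.
Qed.

Lemma measurable_nonexpansive (h : X -> X) : (forall y z, d (h y) (h z) <= d y z) ->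
  measurable_fun setT (h : borel X -> borel X).
Proof.
move=> hh; apply: (measurability (@open X : set (set (borel X)))) => //.
move=> _ [U oU <-]; rewrite setTI; apply: measurable_openX.
apply: open_mdist => y /(open_mdistP oU)[e e0 eU]; exists e => // z yz.
by apply: eU; apply: le_lt_trans yz.
Qed.

(** The law of the image depends only on the law of [f], so one [nu] serves all maps. For [a]
    outside [0, 1] the property is vacuous and [scale] takes an arbitrary value. *)
Lemma scale_subproof x (a : R) mu : exists nu, 0 <= a <= 1 ->
  forall f, law f = mu -> exists g, law g = nu /\ forall w, g w = homothety x a (f w).
Proof.
have [a01|] := boolP (0 <= a <= 1); last by exists (delta x).
have mh : measurable_fun setT (homothety x a : borel X -> borel X).
  apply: measurable_nonexpansive => y z.
  apply: le_trans (homothety_contraction geoX catX x y z a01) _.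
  by move: a01 => /andP[a0 a1]; rewrite ler_piMl// mdist_ge0.
have bh y : d point (homothety x a y) <= 2 * d point x + 1 * d point y.
  have := homothety_dist geoX x y a01 (_ : 0 <= 0 <= 1).
  rewrite lexx ler01 => /(_ isT); have [_ -> _] := homothetyP geoX x y.
  have /andP[a0 a1] := a01; rewrite subr0 ger0_norm// => h.
  have := metric_triangle point x (homothety x a y).
  have := metric_triangle x point y.
  rewrite (metric_sym x (homothety x a y)) (metric_sym x point) h.
  have := mdist_ge0 x y; nra.
have [f0 f0E] := law_surj sepX mu.
exists (law (compL2 sepX mh bh f0)) => _ f fE.
exists (compL2 sepX mh bh f); split => //.
apply: W2_ext => A mA; rewrite !lawE//.
have mhA : measurable (homothety x a @^-1` A : set (borel X)).
  by rewrite -[X in measurable X]setTI; exact: mh.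
by have := law_eqP (etrans fE (esym f0E)) mhA.
Qed.

Definition scale x a mu : W2 X := projT1 (cid (scale_subproof x a mu)).

Lemma scaleP x a f : 0 <= a <= 1 ->
  exists g, law g = scale x a (law f) /\ forall w, g w = homothety x a (f w).
Proof.
by move=> a01; apply: (projT2 (cid (scale_subproof x a (law f))) a01).
Qed.

Lemma sqdist_delta x f : sqdist unif (cstL2 unif x) f = N x (law f) ^+ 2.
Proof. by rewrite W_delta// sqr_sqrtr// sqdist_ge0. Qed.

Lemma W_sq_le f g : W (law f) (law g) ^+ 2 <= sqdist unif f g.
Proof.
rewrite -(@sqr_sqrtr _ (sqdist _ _ _)) ?sqdist_ge0//.
by apply: lerXn2r (W_le sepX f g); rewrite nnegrE ?W_ge0 ?sqrtr_ge0.
Qed.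

(** For [e <= 1] the square of [w + e] is at most [w ^+ 2 + (2 * w + 1) * e]: an error linear in
    [e], as [le_lim] expects. *)
Lemma W_lift_sq f nu (e : R) : 0 < e <= 1 -> exists g, law g = nu /\
  sqdist unif f g <= W (law f) nu ^+ 2 + (2 * W (law f) nu + 1) * e.
Proof.
move=> /andP[e0 e1].
have [|g [<- fg]] := @W_lift _ _ sepX f nu (W (law f) nu + e); first by rewrite ltrDl.
exists g; split => //; set w := W _ _ in fg *.
have w0 : 0 <= w by exact: W_ge0.
apply: (@le_trans _ _ ((w + e) ^+ 2)); last by nra.
rewrite -(@sqr_sqrtr _ (sqdist _ _ _)) ?sqdist_ge0//.
by apply: lerXn2r (ltW fg); rewrite nnegrE ?sqrtr_ge0//; lra.
Qed.

Lemma scale_contraction x (a : R) mu nu : 0 <= a <= 1 ->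
  W (scale x a mu) (scale x a nu) <= a * W mu nu.
Proof.
move=> a01; have /andP[a0 a1] := a01.
rewrite -(@ler_pXn2r _ 2) ?nnegrE ?mulr_ge0 ?W_ge0// exprMn.
apply: (@le_lim _ _ (a ^+ 2 * (2 * W mu nu + 1))).
  by rewrite mulr_ge0 ?sqr_ge0// addr_ge0// mulr_ge0// W_ge0.
move=> e e01; have [f fE] := law_surj sepX mu.
have [g [gE fg]] := W_lift_sq f nu e01; rewrite fE in fg.
have [f' [f'E f'h]] := scaleP x f a01; have [g' [g'E g'h]] := scaleP x g a01.
rewrite -fE -gE -f'E -g'E; apply: le_trans (W_sq_le _ _) _.
have := @sqdist_lincomb _ _ sepX _ _ unif [:: (a ^+ 2, f, g); (-1, f', g')].
rewrite !big_cons big_nil/= addr0 fE gE => h.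
apply: (@le_trans _ _ (a ^+ 2 * sqdist unif f g)); last first.
  by have := sqr_ge0 a; nra.
suff : 0 <= a ^+ 2 * sqdist unif f g + -1 * sqdist unif f' g' by lra.
apply: h => w; rewrite !big_cons big_nil/= addr0 f'h g'h -exprMn.
have := homothety_contraction geoX catX x (f w) (g w) a01.
move/(lerXn2r 2); rewrite !nnegrE mulr_ge0 ?mdist_ge0// => /(_ isT isT); lra.
Qed.

(** After integration only [sqdist unif f g] on the right is inexact, and its coefficient [b] is
    nonnegative, so a near-optimal lift suffices; the other two terms are distances to a constant
    map. *)
Lemma scale_CN x (b : R) mu nu : 0 <= b <= 1 ->
  W mu (scale x b nu) ^+ 2 <= (1 - b) * N x mu ^+ 2 + b * W mu nu ^+ 2 -
    b * (1 - b) * N x nu ^+ 2.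
Proof.
move=> b01; have /andP[b0 b1] := b01.
apply: (@le_lim _ _ (2 * W mu nu + 1)).
  by rewrite addr_ge0// mulr_ge0// W_ge0.
move=> e e01; have [f fE] := law_surj sepX mu.
have [g [gE fg]] := W_lift_sq f nu e01; rewrite fE in fg.
have [g' [g'E g'h]] := scaleP x g b01.
rewrite -{1}fE -{1}gE -g'E; apply: le_trans (W_sq_le _ _) _.
have := @sqdist_lincomb _ _ sepX _ _ unif [:: (1 - b, cstL2 unif x, f); (b, f, g);
  (- (b * (1 - b)), cstL2 unif x, g); (-1, f, g')].
rewrite !big_cons big_nil/= addr0 !sqdist_delta fE gE => h.
suff : 0 <= (1 - b) * N x mu ^+ 2 + (b * sqdist unif f g + (- (b * (1 - b)) * N x nu ^+ 2 +
    -1 * sqdist unif f g')).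
  have : b * sqdist unif f g <= b * W mu nu ^+ 2 + (2 * W mu nu + 1) * e.
    apply: le_trans (ler_wpM2l b0 fg) _; rewrite mulrDr lerD2l ler_piMl//.
    by move: e01 => /andP[e0 _]; rewrite mulr_ge0 ?(ltW e0)// addr_ge0// mulr_ge0// W_ge0.
  by lra.
apply: h => w; rewrite !big_cons big_nil/= addr0 g'h.
have := homothety_CN geoX catX x (f w) (g w) b01; lra.
Qed.

Lemma scale_dist_le x (a b : R) mu : 0 <= a <= 1 -> 0 <= b <= 1 ->
  W (scale x a mu) (scale x b mu) <= `|a - b| * N x mu.
Proof.
move=> a01 b01; have [f <-] := law_surj sepX mu.
have [f' [<- f'h]] := scaleP x f a01; have [g' [<- g'h]] := scaleP x f b01.
rewrite -(@ler_pXn2r _ 2) ?nnegrE ?mulr_ge0 ?W_ge0// exprMn -sqdist_delta.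
apply: le_trans (W_sq_le _ _) _.
have := @sqdist_lincomb _ _ sepX _ _ unif [:: (`|a - b| ^+ 2, cstL2 unif x, f); (-1, f', g')].
rewrite !big_cons big_nil/= addr0 => h.
suff : 0 <= `|a - b| ^+ 2 * sqdist unif (cstL2 unif x) f + -1 * sqdist unif f' g' by lra.
apply: h => w; rewrite !big_cons big_nil/= addr0 f'h g'h homothety_dist// exprMn; lra.
Qed.

Lemma scale0 x mu : scale x 0 mu = delta x.
Proof.
have h01 : 0 <= (0 : R) <= 1 by rewrite lexx ler01.
apply/esym/(W_eq0 sepX)/eqP; rewrite -sqrf_eq0 eq_le sqr_ge0 andbT.
apply: le_trans (scale_CN x (delta x) mu h01) _.
by rewrite Wxx//; lra.
Qed.

Lemma scale1 x mu : scale x 1 mu = mu.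
Proof.
have h01 : 0 <= (1 : R) <= 1 by rewrite lexx ler01.
apply/esym/(W_eq0 sepX)/eqP; rewrite -sqrf_eq0 eq_le sqr_ge0 andbT.
apply: le_trans (scale_CN x mu mu h01) _.
by rewrite Wxx//; lra.
Qed.

(** The upper bounds for the three pieces of the path from [delta x] through both points to [mu] add
    up to [N x mu], so each of them is attained. *)
Lemma scale_dist x (a b : R) mu : 0 <= a <= 1 -> 0 <= b <= 1 ->
  W (scale x a mu) (scale x b mu) = `|a - b| * N x mu.
Proof.
wlog ab : a b / a <= b => [wl a01 b01|a01 b01].
  have [ab|/ltW ba] := leP a b; first exact: wl.
  by rewrite W_sym// distrC; exact: wl.
apply/eqP; rewrite eq_le scale_dist_le//=.
have h0 : 0 <= (0 : R) <= 1 by rewrite lexx ler01.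
have h1 : 0 <= (1 : R) <= 1 by rewrite lexx ler01.
have /andP[a0 a1] := a01; have /andP[b0 b1] := b01.
have := scale_dist_le x mu h0 a01; have := scale_dist_le x mu b01 h1.
rewrite scale0 scale1 sub0r normrN (ger0_norm a0).
rewrite (distrC b) (distrC a) !ger0_norm ?subr_ge0// => u v.
have := W_triangle sepX (scale x a mu) (delta x) mu.
have := W_triangle sepX (scale x b mu) (scale x a mu) mu.
nra.
Qed.

(** The two ends are lifted from one map [f] of the intermediate law. By CN the mean squared
    distance from [f] to the points of ratio [l] between [f0] and [f1] is small: its main terms
    cancel, as [sqdist unif f0 f1] is at least [L ^+ 2]. A second use of CN, from [x], then bounds
    [N x mut]. *)
Lemma delta_sq_convex x (l L : R) mu0 mut mu1 : 0 <= l <= 1 ->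
  W mu0 mu1 = L -> W mu0 mut = l * L -> W mut mu1 = (1 - l) * L ->
  N x mut ^+ 2 <= (1 - l) * N x mu0 ^+ 2 + l * N x mu1 ^+ 2 - l * (1 - l) * L ^+ 2.
Proof.
move=> l01 W01 W0t Wt1; have /andP[l0 l1] := l01.
have L0 : 0 <= L by rewrite -W01 W_ge0.
set A := _ + _ - _.
have [f fE] := law_surj sepX mut.
(* The limit in [e] is taken first, with [k] fixed, because the error carries the weight [1 + k^-1];
   then [k] tends to 0. *)
suff key (k : R) : 0 < k -> N x mut ^+ 2 <= (1 + k) * A.
  apply: (@le_lim _ _ `|A|) => // k /andP[k0 _].
  apply: le_trans (key k k0) _; rewrite mulrDl mul1r lerD2l mulrC.
  by apply: ler_wpM2r; [exact: ltW|exact: ler_norm].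
move=> k0; have ki0 : 0 < k^-1 by rewrite invr_gt0.
apply: (@le_lim _ _ ((1 + k^-1) * (2 * L + 1))).
  by rewrite mulr_ge0//; lra.
move=> e e01; have e0 : 0 < e by case/andP: e01.
have [f0 [f0E ff0]] := W_lift_sq f mu0 e01; have [f1 [f1E ff1]] := W_lift_sq f mu1 e01.
rewrite fE (W_sym sepX mut) W0t in ff0; rewrite fE Wt1 in ff1.
pose c := cstL2 (@unif R) x.
pose m := l * (1 - l).
have := @sqdist_lincomb _ _ sepX _ _ unif [:: ((1 + k) * (1 - l), c, f0); ((1 + k) * l, c, f1);
  (- (2 + k + k^-1) * m, f0, f1); ((1 + k^-1) * (1 - l), f, f0);
  ((1 + k^-1) * l, f, f1); (-1, c, f)].
rewrite !big_cons big_nil/= addr0 !sqdist_delta fE f0E f1E => h.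
have {h} : N x mut ^+ 2 <=
    (1 + k) * ((1 - l) * N x mu0 ^+ 2 + l * N x mu1 ^+ 2 - m * sqdist unif f0 f1) +
    (1 + k^-1) * ((1 - l) * sqdist unif f f0 + l * sqdist unif f f1 - m * sqdist unif f0 f1).
  rewrite -subr_ge0.
  match goal with |- is_true (_ <= ?u) => suff -> : u = (1 + k) * (1 - l) * N x mu0 ^+ 2 +
    ((1 + k) * l * N x mu1 ^+ 2 + (- (2 + k + k^-1) * m * sqdist unif f0 f1 +
    ((1 + k^-1) * (1 - l) * sqdist unif f f0 + ((1 + k^-1) * l * sqdist unif f f1 +
    -1 * N x mut ^+ 2)))) end; last by ring.
  apply: h => w; rewrite !big_cons big_nil/= addr0.
  have xm := homothety_CN geoX catX (f0 w) x (f1 w) l01.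
  have ym := homothety_CN geoX catX (f0 w) (f w) (f1 w) l01.
  have := dist2_weighted k0 xm ym.
  rewrite (metric_sym (f0 w) x) (metric_sym (f0 w) (f w)) -/m => h.
  rewrite -subr_ge0 in h.
  by move: h; congr (_ <= _); ring.
have LQ : L ^+ 2 <= sqdist unif f0 f1 by rewrite -W01 -f0E -f1E; exact: W_sq_le.
have m0 : 0 <= m by rewrite mulr_ge0// subr_ge0.
move=> /le_trans; apply.
rewrite -[in leRHS]mulrA; apply: lerD; apply: ler_wpM2l; [lra| |lra|].
  by rewrite /A lerB// ler_wpM2l.
have e1 : (1 - l) * sqdist unif f f0 <= (1 - l) * ((l * L) ^+ 2 + (2 * (l * L) + 1) * e).
  by apply: ler_wpM2l => //; lra.
have e2 : l * sqdist unif f f1 <= l * (((1 - l) * L) ^+ 2 + (2 * ((1 - l) * L) + 1) * e).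
  exact: ler_wpM2l.
have e3 : m * L ^+ 2 <= m * sqdist unif f0 f1 by apply: ler_wpM2l.
have h4 : 4 * m <= 1 by rewrite /m; have := sqr_ge0 (1 - 2 * l); nra.
have Le : 0 <= L * e by rewrite mulr_ge0// ltW.
have h5 : 4 * m * (L * e) <= 1 * (L * e) by apply: ler_wpM2r.
have E1 : (1 - l) * ((l * L) ^+ 2 + (2 * (l * L) + 1) * e) +
    l * (((1 - l) * L) ^+ 2 + (2 * ((1 - l) * L) + 1) * e) =
    m * L ^+ 2 + 4 * m * (L * e) + e by rewrite /m; ring.
rewrite (_ : (2 * L + 1) * e = 2 * (L * e) + e); last by ring.
lra.
Qed.

End Scale.

(** * Rays issuing from a Dirac mass *)

(* [lra] compares atoms up to conversion, which would unfold [W] and [scale]. *)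
Opaque W scale.

Ltac gen_W := repeat match goal with |- context [W ?a ?b] =>
  let w := fresh "w" in generalize (W a b); intro w end.

Section Rays.
Context {R : realType} {X : completePMetricType R}.
Local Notation N x mu := (W (delta x) mu).
Hypothesis hX : hadamard X.
Implicit Types (mu nu rho : W2 X) (x y : X) (gamma : R -> W2 X).

Let sepX : separable X. Proof. by case: hX. Qed.
Local Notation scale := (scale hX).

Lemma ratio01 (a b : R) : 0 <= a <= b -> 0 <= a / b <= 1.
Proof.
move=> /andP[a0 ab]; have b0 := le_trans a0 ab; rewrite divr_ge0//=.
have [->|b1] := eqVneq b 0; first by rewrite invr0 mulr0.
by rewrite ler_pdivrMr ?mul1r// lt_neqAle eq_sym b1.
Qed.

Lemma W_dist_le mu nu rho : `|W rho mu - W rho nu| <= W mu nu.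
Proof.
have := W_triangle sepX mu rho nu; have := W_triangle sepX nu rho mu.
rewrite (W_sym sepX nu mu) ler_norml => *; apply/andP; split; lra.
Qed.

Lemma scale_norm x (a : R) mu : 0 <= a <= 1 -> N x (scale x a mu) = a * N x mu.
Proof.
move=> a01; rewrite -{1}(scale0 hX x mu) scale_dist// ?lexx ?ler01//.
by rewrite sub0r normrN ger0_norm//; case/andP: a01.
Qed.

(** With these two distances the right-hand side of [scale_CN] vanishes. This is the uniqueness of
    geodesics issuing from a Dirac mass. *)
Lemma scale_unique x (a : R) mu nu : 0 <= a <= 1 ->
  N x mu = a * N x nu -> W mu nu = (1 - a) * N x nu -> mu = scale x a nu.
Proof.
move=> a01 h1 h2; apply/(W_eq0 sepX)/eqP; rewrite -sqrf_eq0 eq_le sqr_ge0 andbT.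
apply: le_trans (scale_CN hX x mu nu a01) _; rewrite h1 h2.
by rewrite le_eqVlt; apply/orP; left; apply/eqP; ring.
Qed.

Lemma scale_comp x (a b : R) mu : 0 <= a <= 1 -> 0 <= b <= 1 ->
  scale x a (scale x b mu) = scale x (a * b) mu.
Proof.
move=> a01 b01; have /andP[a0 a1] := a01; have /andP[b0 b1] := b01.
have ab01 : 0 <= a * b <= 1 by rewrite mulr_ge0//= mulr_ile1.
apply/esym/scale_unique; rewrite ?scale_norm//; first by rewrite mulrA.
rewrite scale_dist// distrC ger0_norm ?subr_ge0; last by rewrite ler_piMl.
by rewrite -[X in X - _]mul1r -mulrBl mulrA.
Qed.

(* Busemann convexity towards a Dirac mass: the two-sided comparison is only
   available with a vertex at a Dirac mass, so the 2-convexity of the squared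
   distance to [delta x] makes up for the side opposite to [delta x]. *)
Lemma scale_triangle x (s t : R) mu0 mus mut : 0 <= s <= t -> 0 < t ->
  W mu0 mut = t -> W mu0 mus = s -> W mus mut = t - s ->
  W mus (scale x (s / t) mut) <= N x mu0.
Proof.
move=> st t0 h0t h0s hst; have b01 := ratio01 st; have /andP[b0 b1] := b01.
have st' : s = s / t * t by rewrite divfK// gt_eqF.
rewrite -(@ler_pXn2r _ 2) ?nnegrE ?W_ge0//.
apply: le_trans (scale_CN hX x mus mut b01) _; rewrite hst.
have tE : t - s = (1 - s / t) * t by rewrite mulrBl mul1r -st'.
(* Multiplied by [1 - b], where [b = s / t], this cancels the CN terms in [N x mut] and in [t],
   leaving [(1 - b) ^+ 2 * N x mu0 ^+ 2]. *)
have := delta_sq_convex hX x b01 h0t (etrans h0s st') (etrans hst tE).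
rewrite tE; move: (s / t) b0 b1 => b b0 b1 h.
have := ler_wpM2l (_ : 0 <= 1 - b) h; rewrite subr_ge0 => /(_ b1) {}h.
apply: (@le_trans _ _ ((1 - b) ^+ 2 * N x mu0 ^+ 2)); first by lra.
by rewrite ler_piMl ?sqr_ge0// exprn_ile1//; lra.
Qed.

(** The homothety of ratio [r / s] contracts the bound of [scale_triangle], which produces the decay
    in [s]. *)
Lemma scale_cauchy x (r s t : R) mu0 mus mut : 0 <= r <= s -> 0 < s -> s <= t ->
  W mu0 mut = t -> W mu0 mus = s -> W mus mut = t - s ->
  W (scale x (r / s) mus) (scale x (r / t) mut) <= r / s * N x mu0.
Proof.
move=> rs s0 st h0t h0s hst; have a01 := ratio01 rs.
have st' : 0 <= s <= t by rewrite ltW.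
have -> : r / t = r / s * (s / t) by rewrite mulrA divfK// gt_eqF.
rewrite -(scale_comp x mut a01 (ratio01 st')).
apply: le_trans (scale_contraction hX x mus (scale x (s / t) mut) a01) _.
apply: ler_wpM2l; first by case/andP: a01.
by apply: scale_triangle h0t h0s hst => //; exact: lt_le_trans st.
Qed.

(** For [0 <= r <= N x mu] this parametrizes the geodesic from [delta x] to [mu] by arc length,
    where [scale] uses ratios. *)
Definition radial x mu (r : R) : W2 X := scale x (r / N x mu) mu.

Lemma radial_scale x (r s C : R) mu : 0 <= r <= s -> 0 < s -> r <= N x mu ->
  `|N x mu - s| <= C -> W (scale x (r / s) mu) (radial x mu r) <= r / s * C.
Proof.
move=> rs s0 rN Ns; have /andP[r0 _] := rs.
have rN01 : 0 <= r / N x mu <= 1 by apply: ratio01; rewrite r0.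
rewrite scale_dist//; last exact: ratio01.
have [N0|Nn0] := eqVneq (N x mu) 0.
  by rewrite N0 mulr0 mulr_ge0 ?(le_trans _ Ns)// divr_ge0 ?(ltW s0).
have N0 : 0 < N x mu by rewrite lt_neqAle eq_sym Nn0 W_ge0.
rewrite -{2}(ger0_norm (ltW N0)) -normrM.
have -> : (r / s - r / N x mu) * N x mu = r / s * (N x mu - s).
  by field; rewrite !gt_eqF.
rewrite normrM ger0_norm; last by rewrite divr_ge0 ?(ltW s0).
by apply: ler_wpM2l => //; rewrite divr_ge0 ?(ltW s0).
Qed.

(** The factor 2 adds the contraction at the fixed ratio [r / N x mu] and the correction of this
    ratio for [nu]. *)
Lemma radial_lipschitz x (r : R) mu nu : 0 <= r -> r <= N x mu -> r <= N x nu ->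
  0 < N x mu -> W (radial x mu r) (radial x nu r) <= 2 * (r / N x mu) * W mu nu.
Proof.
move=> r0 rm rn N0.
have a01 : 0 <= r / N x mu <= 1 by apply: ratio01; rewrite r0.
apply: le_trans (W_triangle sepX (scale x (r / N x mu) nu) _ _) _.
have h1 := scale_contraction hX x mu nu a01.
have h2 : W (scale x (r / N x mu) nu) (radial x nu r) <= r / N x mu * W mu nu.
  apply: radial_scale => //; first by rewrite r0.
  by rewrite distrC; exact: W_dist_le.
have h3 := lerD h1 h2.
apply: le_trans h3 _.
move: (W mu nu) (r / N x mu) => u v.
rewrite (_ : 2 * v * u = v * u + v * u) ?lexx//.
ring.
Qed.

(** There are three errors of size at most [r * C / s]: the passage between arc length and ratio at
    each of the two measures, and [scale_cauchy] in between. *)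
Lemma radial_cauchy x (r s t C : R) mu0 mus mut : 0 <= r -> r + C <= s -> 0 < s ->
  s <= t -> N x mu0 = C -> W mu0 mut = t -> W mu0 mus = s -> W mus mut = t - s ->
  W (radial x mus r) (radial x mut r) <= 3 * (r * C) / s.
Proof.
move=> r0 rCs s0 st hC h0t h0s hst.
have C0 : 0 <= C by rewrite -hC W_ge0.
have Ns m u : W mu0 m = u -> `|N x m - u| <= C.
  by move=> <-; rewrite -hC (W_sym sepX (delta x) m) (W_sym sepX mu0 m); exact: W_dist_le.
have rN m u : W mu0 m = u -> s <= u -> r <= N x m.
  by move=> /Ns; rewrite ler_norml => /andP[]; lra.
have rs : 0 <= r <= s by rewrite r0; lra.
have t0 := lt_le_trans s0 st.
have rt : 0 <= r <= t by rewrite r0; lra.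
have h1 := radial_scale rs s0 (rN _ _ h0s (lexx _)) (Ns _ _ h0s).
have h2 := scale_cauchy x rs s0 st h0t h0s hst.
have h3 := radial_scale rt t0 (rN _ _ h0t st) (Ns _ _ h0t).
have h4 : r / t * C <= r / s * C.
  by apply: ler_wpM2r => //; apply: ler_wpM2l => //; rewrite lef_pV2 ?posrE.
apply: le_trans (W_triangle sepX (scale x (r / s) mus) _ _) _.
have := W_triangle sepX (scale x (r / t) mut) (scale x (r / s) mus) (radial x mut r).
rewrite (W_sym sepX (radial x mus r)); rewrite hC in h2.
rewrite (_ : 3 * (r * C) / s = 3 * (r / s * C)); last by ring.
move: (r / s * C) (r / t * C) h1 h2 h3 h4 => ? ?; gen_W; clear; lra.
Qed.

Lemma unit_rayP gamma : unit_ray (@W R X) gamma ->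
  forall s t, 0 <= s -> s <= t -> W (gamma s) (gamma t) = t - s.
Proof.
move=> g s t s0 st; rewrite g ?in_itv/= ?s0 ?(le_trans s0 st)//.
by rewrite mul1r distrC ger0_norm// subr_ge0.
Qed.

Lemma le_div_eq0 (A K s0 : R) : (forall s, s0 < s -> A <= K / s) -> A <= 0.
Proof.
move=> h; rewrite leNgt; apply/negP => A0.
pose s := Num.max 1 (Num.max (s0 + 1) ((K + 1) / A)).
have s1 : 1 <= s by rewrite le_max lexx.
have ss0 : s0 + 1 <= s by rewrite !le_max lexx orbT.
have sK : (K + 1) / A <= s by rewrite !le_max lexx !orbT.
have := h s; rewrite ler_pdivlMr; last by lra.
move: sK; rewrite ler_pdivrMr// => sK /(_ _); lra.
Qed.

Lemma asymptotic_ray x gamma : unit_ray (@W R X) gamma ->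
  exists rho : R -> W2 X, [/\ unit_ray (@W R X) rho, rho 0 = delta x,
    asymptotic (@W R X) gamma rho &
    forall r s, 0 <= r <= s -> 0 < s ->
      W (scale x (r / s) (gamma s)) (rho r) <= r / s * N x (gamma 0)].
Proof.
move=> ray; have rayP := unit_rayP ray.
pose C := N x (gamma 0); have C0 : 0 <= C by exact: W_ge0.
have ray0 s : 0 <= s -> W (gamma 0) (gamma s) = s by move=> s0; rewrite rayP// subr0.
have cauchy r s t : 0 <= r <= s -> 0 < s -> s <= t ->
    W (scale x (r / s) (gamma s)) (scale x (r / t) (gamma t)) <= r / s * C.
  move=> rs s0 st; apply: scale_cauchy => //; rewrite ?ray0 ?rayP//; lra.
have lim r : exists l, 0 <= r -> forall s, r <= s -> 0 < s ->
    W (scale x (r / s) (gamma s)) l <= r / s * C.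
  have [r0|] := boolP (0 <= r); last by exists (delta x).
  have q1 n : 1 <= (2 : R) ^+ n by apply: exprn_ege1; lra.
  (* Times growing like the powers of 4 give the rate asked by [W2_geometric_cvg]; the factor
     [r + 1] is positive and keeps every time above [r]. *)
  pose sn (n : nat) : R := (r + 1) * (2 ^+ n) ^+ 2.
  have sn1 n : r + 1 <= sn n.
    by rewrite ler_peMr; [|lra|by rewrite exprn_ege1].
  have [||l lP] := @W2_geometric_cvg _ _ sepX (fun n => scale x (r / sn n) (gamma (sn n))) C.
  - exact: C0.
  - move=> n; apply: le_trans (cauchy _ _ _ _ _ _) _.
    + by rewrite r0/=; have := sn1 n; lra.
    + by have := sn1 n; lra.
    + rewrite /sn ler_wpM2l ?addr_ge0// (exprS _ n) exprMn ler_peMl ?sqr_ge0//.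
    + rewrite mulrC ler_wpM2l// /sn invfM mulrA ler_piMl ?invr_ge0 ?sqr_ge0//.
      by rewrite ler_pdivrMr; lra.
  exists l => _ s rs s0.
  (* The limit along [sn] is compared with an arbitrary time [s] through some [sn n] beyond [s]. *)
  apply/ler_addgt0Pr => e e0.
  have [n1 h1] := geometric_small (3 * (C + 1)) e0.
  have [n2 h2] := geometric_small s (ltr01 : 0 < 1 :> R).
  pose n := maxn n1 n2.
  have ss : s <= sn n.
    have : s <= 2 ^+ n2 by move: h2; rewrite ltr_pdivrMr ?exprn_gt0// mul1r => /ltW.
    move=> /le_trans; apply; apply: (@le_trans _ _ (2 ^+ n)).
      by rewrite ler_weXn2l ?leq_maxr//; lra.
    apply: (@le_trans _ _ ((2 ^+ n) ^+ 2)); first by rewrite ler_eXnr.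
    by rewrite ler_peMl ?sqr_ge0//; lra.
  apply: le_trans (W_triangle sepX (scale x (r / sn n) (gamma (sn n))) _ _) _.
  apply: lerD; first by apply: cauchy => //; rewrite r0.
  apply: le_trans (lP n) _; apply: le_trans (ltW h1).
  rewrite ler_wpM2l//; first by lra.
  by rewrite lef_pV2 ?posrE ?exprn_gt0// ler_weXn2l ?leq_maxl//; lra.
have [rho rhoP] := choice lim.
have bound r s : 0 <= r <= s -> 0 < s ->
    W (scale x (r / s) (gamma s)) (rho r) <= r / s * C.
  by move=> /andP[r0 rs] s0; exact: rhoP.
have rho0 : rho 0 = delta x.
  have h01 : 0 <= (0 : R) <= 1 by rewrite lexx ler01.
  have := bound 0 1 h01 ltr01; rewrite !mul0r scale0 => h.
  by apply/esym/(W_eq0 sepX)/eqP; rewrite eq_le h W_ge0.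
exists rho; split => //.
(* Unit speed: the approximants at time [s] are [|r - t| / s * N x (gamma s)] apart, and
   [N x (gamma s)] is within [C] of [s]. The total error [K / s] tends to 0. *)
- move=> r t; rewrite !in_itv/= !andbT => r0 t0; rewrite mul1r.
  pose K := (r + t + `|r - t|) * C.
  have h s : r + t < s -> `|W (rho r) (rho t) - `|r - t| | <= K / s.
    move=> rts; have s0 : 0 < s by lra.
    have rs : 0 <= r <= s by rewrite r0; lra.
    have ts : 0 <= t <= s by rewrite t0; lra.
    have b1 := bound _ _ rs s0; have b2 := bound _ _ ts s0.
    have Ns : `|N x (gamma s) - s| <= C.
      rewrite -{2}(ray0 s (ltW s0)) (W_sym sepX (delta x) (gamma s)).
      rewrite (W_sym sepX (gamma 0) (gamma s)); exact: W_dist_le.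
    have e := scale_dist hX x (gamma s) (ratio01 rs) (ratio01 ts).
    have t1 := W_triangle sepX (scale x (r / s) (gamma s)) (rho r) (rho t).
    have t2 := W_triangle sepX (scale x (t / s) (gamma s)) (scale x (r / s) (gamma s)) (rho t).
    have t3 := W_triangle sepX (rho r) (scale x (r / s) (gamma s)) (scale x (t / s) (gamma s)).
    have t4 := W_triangle sepX (rho t) (rho r) (scale x (t / s) (gamma s)).
    rewrite (W_sym sepX (rho r) (scale _ _ _)) in t1.
    rewrite (W_sym sepX (rho t) (scale _ _ _)) in t4.
    have e' : `| `|r / s - t / s| * N x (gamma s) - `|r - t| | <= `|r - t| * C / s.
      rewrite -mulrBl normrM (ger0_norm (_ : 0 <= s^-1)) ?invr_ge0 ?(ltW s0)//.
      rewrite (_ : _ - `|r - t| = `|r - t| / s * (N x (gamma s) - s)); last first.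
        by field; rewrite gt_eqF.
      rewrite normrM ger0_norm; last by rewrite divr_ge0// ltW.
      by rewrite [leRHS]mulrAC; apply: ler_wpM2l => //; rewrite divr_ge0// ltW.
    rewrite e in t2 t3; move: e'; rewrite !ler_norml => /andP[e1 e2].
    rewrite (_ : K / s = r / s * C + t / s * C + `|r - t| * C / s); last by rewrite /K; ring.
    by apply/andP; split; lra.
  by apply/eqP; rewrite -subr_eq0 -normr_le0; apply: le_div_eq0 h.
(* For [t > 0] the bound is used with [r = s = t], where the homothety is the identity. *)
- exists C => t; rewrite le_eqVlt => /predU1P[<-|t0].
    by rewrite rho0 W_sym.
  have := bound t t; rewrite divff ?gt_eqF// scale1 mul1r; apply => //.
  by rewrite lexx ltW.
Qed.

Lemma ray_fixed x gamma (r t : R) : unit_ray (@W R X) gamma -> gamma 0 = delta x ->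
  0 <= r <= t -> 0 < t -> gamma r = scale x (r / t) (gamma t).
Proof.
move=> ray g0 rt t0; have /andP[r0 rt'] := rt.
have Nt s : 0 <= s -> N x (gamma s) = s.
  by move=> s0; rewrite -g0 (unit_rayP ray) ?subr0.
apply: scale_unique; first exact: ratio01.
  by rewrite !Nt ?(ltW t0)// divfK// gt_eqF.
rewrite (unit_rayP ray)// Nt ?(ltW t0)// mulrBl mul1r divfK// gt_eqF//.
Qed.

(** The points at time [r] are images of those at time [t] under the homothety of ratio [r / t],
    which shrinks the bounded gap to 0 as [t] grows. *)
Lemma ray_unique x gamma gamma' : unit_ray (@W R X) gamma -> gamma 0 = delta x ->
  unit_ray (@W R X) gamma' -> gamma' 0 = delta x -> asymptotic (@W R X) gamma gamma' ->
  forall r, 0 <= r -> gamma r = gamma' r.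
Proof.
move=> ray g0 ray' g0' [K KP] r r0.
apply/(W_eq0 sepX)/eqP; rewrite eq_le W_ge0 andbT.
apply: (@le_div_eq0 _ (r * K) r) => t rt.
have t0 : 0 < t := le_lt_trans r0 rt.
have rt' : 0 <= r <= t by rewrite r0 ltW.
rewrite (ray_fixed ray g0 rt' t0) (ray_fixed ray' g0' rt' t0).
apply: le_trans (scale_contraction hX x _ _ (ratio01 rt')) _.
rewrite mulrAC; apply: ler_wpM2r; first by rewrite invr_ge0 ltW.
by apply: ler_wpM2l => //; apply: KP; exact: ltW.
Qed.

Lemma segment_fixed x mu gamma : 0 < N x mu ->
  unit_geodesic_to x (inl mu) gamma ->
  forall r, 0 <= r <= N x mu -> gamma r = radial x mu r.
Proof.
move=> N0 [geo g0 gN] r r01.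
have h0 : (0 : R) \in `[0, N x mu] by rewrite in_itv/= lexx ltW.
have hN : N x mu \in `[0, N x mu] by rewrite in_itv/= lexx ltW.
have hr : r \in `[0, N x mu] by rewrite in_itv.
have /andP[r0 rN] := r01.
have := geo _ _ h0 hr; have := geo _ _ hr hN.
rewrite g0 gN !mul1r sub0r normrN (ger0_norm r0) distrC ger0_norm ?subr_ge0// => e2 e1.
apply: scale_unique; first exact: ratio01.
  by rewrite divfK// gt_eqF.
by rewrite mulrBl mul1r divfK// gt_eqF.
Qed.

Lemma segment_exists x mu : 0 < N x mu -> unit_geodesic_to x (inl mu) (radial x mu).
Proof.
move=> N0; split.
- move=> s t; rewrite !in_itv/= => s01 t01.
  rewrite /radial scale_dist; [|exact: ratio01|exact: ratio01].
  rewrite -[X in _ * X]ger0_norm; last exact: ltW.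
  by rewrite -normrM mulrBl !divfK ?gt_eqF// mul1r.
- by rewrite /radial mul0r scale0.
- by rewrite /radial divff ?gt_eqF// scale1.
Qed.

End Rays.

(** * The cone topology *)

Section Cone.
Context {R : realType} {X : completePMetricType R}.
Local Notation N x mu := (W (delta x) mu).
Hypothesis hX : hadamard X.
Implicit Types (mu nu rho : W2 X) (x y : X) (gamma : R -> W2 X).
Implicit Types (theta : W2bar X) (xi : boundary X).

Let sepX : separable X. Proof. by case: hX. Qed.
Local Notation scale := (scale hX).
Local Notation radial := (radial hX).

Definition outside x (r : R) theta : Prop := ~ closed_ball_W2bar (delta x) r theta.

Lemma outside_inl x r mu : outside x r (inl mu) <-> r < N x mu.
Proof.
split=> [h|rN [nu /= nur [e]]]; last by move: rN; rewrite -e ltNge nur.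
by rewrite ltNge; apply/negP => h'; apply: h; exists mu.
Qed.

Lemma outside_inr x r xi : outside x r (inr xi).
Proof. by move=> [nu _]. Qed.

Lemma asymptotic_sym gamma gamma' :
  asymptotic (@W R X) gamma gamma' -> asymptotic (@W R X) gamma' gamma.
Proof. by move=> [K KP]; exists K => t t0; rewrite W_sym//; exact: KP. Qed.

Lemma asymptotic_trans gamma2 gamma1 gamma3 :
  asymptotic (@W R X) gamma1 gamma2 -> asymptotic (@W R X) gamma2 gamma3 ->
  asymptotic (@W R X) gamma1 gamma3.
Proof.
move=> [K KP] [K' KP']; exists (K + K') => t t0.
by apply: le_trans (W_triangle sepX (gamma2 t) _ _) _; rewrite lerD ?KP ?KP'.
Qed.

Lemma boundary_asymptotic xi gamma gamma' :
  boundary_class xi gamma -> boundary_class xi gamma' -> asymptotic (@W R X) gamma gamma'.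
Proof.
have [g rg ->] := boundary_classP xi => -[_ h] [_ h'].
exact: asymptotic_trans (asymptotic_sym h) h'.
Qed.

Lemma boundary_closed xi gamma gamma' : boundary_class xi gamma ->
  unit_ray (@W R X) gamma' -> asymptotic (@W R X) gamma gamma' -> boundary_class xi gamma'.
Proof.
have [g rg ->] := boundary_classP xi => -[_ h] r' h'.
by split => //; exact: asymptotic_trans h h'.
Qed.

Lemma geodesic_to_inr x xi : unit_geodesic_to x (inr xi) (geodesic_to x (inr xi)).
Proof.
have [g rg xiE] := boundary_classP xi.
have [rho [rho_ray rho0 grho _]] := asymptotic_ray hX x rg.
by apply: (@getPex _ (unit_geodesic_to x (inr xi))); exists rho; split; rewrite ?xiE.
Qed.

Lemma geodesic_to_inl x mu r : 0 <= r <= N x mu -> 0 < N x mu ->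
  geodesic_to x (inl mu) r = radial x mu r.
Proof.
move=> r01 N0; apply: segment_fixed => //.
apply: (@getPex _ (unit_geodesic_to x (inl mu))).
by exists (radial x mu); exact: segment_exists.
Qed.

(** One statement for measures and for classes of rays, so that [geodesic_to_contraction] also holds
    for mixed pairs. *)
Lemma geodesic_to_scale x theta (r s : R) : outside x s theta -> 0 <= r <= s -> 0 < s ->
  N x (geodesic_to x theta s) = s /\
  geodesic_to x theta r = scale x (r / s) (geodesic_to x theta s).
Proof.
move=> out rs s0; have /andP[r0 rs'] := rs.
case: theta out => [mu /outside_inl sN|xi _].
  have N0 := lt_trans s0 sN.
  have sN01 : 0 <= s / N x mu <= 1 by apply: ratio01; rewrite !ltW.
  have sN' : 0 <= s <= N x mu by rewrite (ltW s0) (ltW sN).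
  have rN' : 0 <= r <= N x mu by rewrite r0 (le_trans rs' (ltW sN)).
  rewrite (geodesic_to_inl sN' N0) (geodesic_to_inl rN' N0).
  rewrite /radial scale_norm// divfK ?gt_eqF//; split => //.
  rewrite scale_comp//; last exact: ratio01.
  by congr scale; rewrite mulrA divfK// gt_eqF.
have [ray g0 _] := geodesic_to_inr x xi.
split; last exact: ray_fixed.
by rewrite -{1}g0 (unit_rayP ray) ?subr0// ltW.
Qed.

Lemma geodesic_to_contraction x theta theta' (r s : R) : outside x s theta ->
  outside x s theta' -> 0 <= r <= s -> 0 < s ->
  W (geodesic_to x theta r) (geodesic_to x theta' r) <=
  W (geodesic_to x theta s) (geodesic_to x theta' s).
Proof.
move=> o o' rs s0; have [_ ->] := geodesic_to_scale o rs s0.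
have [_ ->] := geodesic_to_scale o' rs s0.
have rs01 := ratio01 rs; have /andP[r0 r1] := rs01.
apply: le_trans (scale_contraction hX x _ _ rs01) _.
by rewrite ler_piMl// W_ge0.
Qed.

Lemma boundary_eq x xi xi' :
  (forall r, 0 <= r -> geodesic_to x (inr xi) r = geodesic_to x (inr xi') r) -> xi = xi'.
Proof.
move=> h.
have [ray _ cl] := geodesic_to_inr x xi.
have [ray' _ cl'] := geodesic_to_inr x xi'.
have aa : asymptotic (@W R X) (geodesic_to x (inr xi)) (geodesic_to x (inr xi')).
  by exists 0 => t t0; rewrite h// Wxx.
have e : boundary_class xi = boundary_class xi'.
  apply/seteqP; split => g gc.
  - have rg : unit_ray (@W R X) g.
      by move: gc; have [k _ ->] := boundary_classP xi => -[].
    apply: boundary_closed cl' rg _.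
    exact: asymptotic_trans (asymptotic_sym aa) (boundary_asymptotic cl gc).
  - have rg : unit_ray (@W R X) g.
      by move: gc; have [k _ ->] := boundary_classP xi' => -[].
    apply: boundary_closed cl rg _.
    exact: asymptotic_trans aa (boundary_asymptotic cl' gc).
clear -e; case: xi xi' e => [c cP] [c' cP'] /= e.
by move: cP cP'; rewrite e => cP cP'; congr MkBoundary; exact: Prop_irrelevance.
Qed.

Lemma N_change x y mu : N y mu - W (delta x) (delta y) <= N x mu.
Proof.
have := W_triangle sepX (delta x) (delta y) mu; rewrite (W_sym sepX (delta y) (delta x)).
by gen_W; clear; lra.
Qed.

(** The estimate behind the independence of the base point. For a measure it is [radial_cauchy] with
    [mu0 = delta y]; for a class it is the rate of [asymptotic_ray], applied to the ray issuing from
    [delta y], combined with [radial_scale]. *)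
Lemma geodesic_to_change x y theta (r s : R) : let C := W (delta x) (delta y) in
  outside y s theta -> 0 <= r -> r + C < s -> 0 < s -> outside x r theta /\
  W (radial x (geodesic_to y theta s) r) (geodesic_to x theta r) <= 3 * (r * C) / s.
Proof.
move=> C out r0 rCs s0; have C0 : 0 <= C by exact: W_ge0.
case: theta out => [mu /outside_inl sN|xi _].
  have rN : r < N x mu by have := N_change x y mu; rewrite -/C; lra.
  split; first exact/outside_inl.
  have N0 := lt_trans s0 sN; have Nx0 := le_lt_trans r0 rN.
  have s01 : 0 <= s <= N y mu by rewrite !ltW.
  rewrite !geodesic_to_inl//; last by rewrite r0 ltW.
  apply: (@radial_cauchy _ _ hX x r s (N y mu) C (delta y)) => //; try exact: ltW.
    by rewrite /radial scale_norm ?divfK ?gt_eqF//; exact: ratio01.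
  have := scale_dist hX y mu (ratio01 s01) (_ : 0 <= (1 : R) <= 1).
  rewrite scale1 => ->; last by rewrite ler01 lexx.
  rewrite distrC ger0_norm; last by rewrite subr_ge0; case/andP: (ratio01 s01).
  by rewrite mulrBl mul1r divfK// gt_eqF.
split; first exact: outside_inr.
have [ray g0 cl] := geodesic_to_inr y xi.
set gamma := geodesic_to y (inr xi) in ray g0 cl *.
have [rho [rho_ray rho0 grho bound]] := asymptotic_ray hX x ray.
have [ray' g0' cl'] := geodesic_to_inr x xi.
have -> : geodesic_to x (inr xi) r = rho r.
  apply: (ray_unique (x := x) hX) => //.
  exact: asymptotic_trans (boundary_asymptotic cl' cl) grho.
have rs : 0 <= r <= s by rewrite r0; lra.
have := bound _ _ rs s0; rewrite g0 -/C => h1.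
have Ns : `|N x (gamma s) - s| <= C.
  have e : W (gamma 0) (gamma s) = s by rewrite (unit_rayP ray) ?subr0// ltW.
  rewrite -{2}e g0 (W_sym sepX (delta x) (gamma s)) (W_sym sepX (delta y) (gamma s)).
  exact: W_dist_le.
have rN : r <= N x (gamma s) by move: Ns; rewrite ler_norml => /andP[]; lra.
have h2 := radial_scale hX rs s0 rN Ns.
apply: le_trans (W_triangle sepX (scale x (r / s) (gamma s)) _ _) _.
rewrite (W_sym sepX (radial _ _ _)).
rewrite (_ : 3 * (r * C) / s = 3 * (r / s * C)); last by ring.
have : 0 <= r / s * C by rewrite mulr_ge0// divr_ge0// ltW.
by move=> h; apply: le_trans (lerD h2 h1) _; move: (r / s * C) h => {h1 h2} ? h; lra.
Qed.

Lemma open_cone_nbhs x xi (r e : R) : 0 < r ->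
  @W2_open R X (inl @^-1` cone_nbhs x xi r e).
Proof.
move=> r0 mu [/outside_inl rN mue].
pose a := e - W (geodesic_to x (inl mu) r) (geodesic_to x (inr xi) r).
have a0 : 0 < a by rewrite subr_gt0.
(* The first radius keeps [nu] outside the closed ball; halving [a] pays for the factor 2 of
   [radial_lipschitz]. *)
exists (Num.min (N x mu - r) (a / 2)); first by rewrite lt_min subr_gt0 rN divr_gt0.
move=> nu /=; rewrite lt_min => /andP[h1 h2].
have rN' : r < N x nu.
  have := W_triangle sepX nu (delta x) mu; rewrite (W_sym sepX nu mu).
  by move: h1; gen_W; clear; lra.
split; first exact/outside_inl.
have N0 := lt_trans r0 rN; have N0' := lt_trans r0 rN'.
apply: le_lt_trans (W_triangle sepX (geodesic_to x (inl mu) r) _ _) _.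
have : W (geodesic_to x (inl nu) r) (geodesic_to x (inl mu) r) <= 2 * W mu nu.
  have rm : 0 <= r <= N x mu by rewrite (ltW r0) (ltW rN).
  have rn : 0 <= r <= N x nu by rewrite (ltW r0) (ltW rN').
  rewrite (geodesic_to_inl rm N0) (geodesic_to_inl rn N0') (W_sym sepX (radial _ _ _)).
  apply: le_trans (radial_lipschitz hX (ltW r0) (ltW rN) (ltW rN') N0) _.
  rewrite ler_wpM2r ?W_ge0// ler_piMr// ler_pdivrMr// mul1r ltW//.
by move: h2; rewrite /a; gen_W; clear; lra.
Qed.

(** The radius [s] stays free above [r], with the same [e0] thanks to [geodesic_to_contraction]; two
    neighbourhoods of [inr xi0] can thus be given a common radius. *)
Lemma cone_nbhs_sub x xi xi0 (r e : R) : 0 < r ->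
  cone_nbhs x xi r e (inr xi0) -> exists2 e0, 0 < e0 & forall s, r <= s ->
  cone_nbhs x xi0 s e0 `<=` cone_nbhs x xi r e.
Proof.
move=> r0 [_ h0]; exists (e - W (geodesic_to x (inr xi0) r) (geodesic_to x (inr xi) r)).
  by rewrite subr_gt0.
move=> s rs theta [out h]; have s0 := lt_le_trans r0 rs.
split.
  case: theta out {h} => [mu /outside_inl sN|xi' _]; last exact: outside_inr.
  by apply/outside_inl; exact: le_lt_trans sN.
have rs' : 0 <= r <= s by rewrite ltW.
have h1 := geodesic_to_contraction out (@outside_inr x s xi0) rs' s0.
apply: le_lt_trans (W_triangle sepX (geodesic_to x (inr xi0) r) _ _) _.
by move: h h1; gen_W; clear; lra.
Qed.

Lemma cone_nbhs_change x y xi (r e : R) : 0 < r -> 0 < e ->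
  exists s e0, [/\ 0 < s, 0 < e0 & cone_nbhs y xi s e0 `<=` cone_nbhs x xi r e].
Proof.
move=> r0 e0; pose C := W (delta x) (delta y); have C0 : 0 <= C by exact: W_ge0.
(* Two changes of base point at [3 * (r * C) / s] and one comparison of radial points at
   [2 * (r / t)] cost at most [K / t], which is below [e] because [t > K / e]. *)
pose K := 6 * (r * C) + 2 * r.
have K0 : 0 < K by have : 0 <= r * C by [rewrite mulr_ge0// ltW]; rewrite /K; lra.
pose t := r + K / e + 1.
have Ke : 0 < K / e by rewrite divr_gt0.
have t0 : 0 < t by rewrite /t; lra.
(* A measure at distance [s] from [delta y] is then at distance at least [t] from [delta x]. *)
pose s := t + C.
have s0 : 0 < s by rewrite /s; lra.
have rCs : r + C < s by rewrite /s /t; lra.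
exists s, 1; split => // theta [out h].
have [out' d1] := geodesic_to_change out (ltW r0) rCs s0.
have [_ d2] := geodesic_to_change (@outside_inr y s xi) (ltW r0) rCs s0.
split => //.
have ss : 0 <= s <= s by rewrite lexx ltW.
have [Nm _] := geodesic_to_scale out ss s0.
have [Nn _] := geodesic_to_scale (@outside_inr y s xi) ss s0.
move: h d1 d2 Nm Nn.
set m := geodesic_to y theta s; set n := geodesic_to y (inr xi) s => h d1 d2 Nm Nn.
have tm : t <= N x m by have := N_change x y m; rewrite Nm -/C /s; lra.
have tn : t <= N x n by have := N_change x y n; rewrite Nn -/C /s; lra.
have rt : r <= t by rewrite /t; lra.
have d3 := radial_lipschitz hX (ltW r0) (le_trans rt tm) (le_trans rt tn) (lt_le_trans t0 tm).
have {}d3 : W (radial x m r) (radial x n r) <= 2 * (r / t).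
  apply: le_trans d3 _; rewrite -[leRHS]mulr1; apply: ler_pM => //.
  - by rewrite mulr_ge0// divr_ge0 ?(ltW r0)// W_ge0.
  - exact: W_ge0.
  - by rewrite ler_pM2l// ler_pM2l// lef_pV2// posrE// (lt_le_trans t0 tm).
  - exact: ltW.
have d4 : 3 * (r * C) / s <= 3 * (r * C) / t.
  apply: ler_wpM2l; first by rewrite mulr_ge0// mulr_ge0// ltW.
  by rewrite lef_pV2 ?posrE// /s lerDl.
have d5 : 2 * (3 * (r * C) / t) + 2 * (r / t) < e.
  rewrite (_ : _ + _ = K / t); last by rewrite /K; ring.
  rewrite ltr_pdivrMr// -ltr_pdivrMl// mulrC /t; lra.
apply: le_lt_trans (W_triangle sepX (radial x m r) _ _) _.
have d6 := W_triangle sepX (radial x n r) (radial x m r) (geodesic_to x (inr xi) r).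
rewrite (W_sym sepX _ (radial x m r)).
move: d1 d2 d3 d4 d5 d6; rewrite -/C.
by move: (3 * (r * C) / s) (3 * (r * C) / t) (r / t) => ? ? ?; gen_W; clear; lra.
Qed.

End Cone.

(** * The topology generated by the cone neighbourhoods *)

Section Topology.
Context {R : realType} {X : completePMetricType R}.
Hypothesis hX : hadamard X.
Implicit Types (mu nu : W2 X) (x y : X) (theta : W2bar X) (xi : boundary X).

Let sepX : separable X. Proof. by case: hX. Qed.

Lemma cone_nbhs_center x xi (r e : R) : 0 < e -> cone_nbhs x xi r e (inr xi).
Proof. by move=> e0; split; [exact: outside_inr|rewrite Wxx]. Qed.

Lemma cone_nbhs_le x xi (r e e' : R) : e <= e' ->
  cone_nbhs x xi r e `<=` cone_nbhs x xi r e'.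
Proof. by move=> ee' theta [out h]; split => //; exact: lt_le_trans ee'. Qed.

Lemma cone_basis_inl x (U : set (W2bar X)) : cone_basis x U ->
  W2_open (inl @^-1` U).
Proof.
move=> [[A oA <-]|[xi [r [e [r0 e0 ->]]]]]; last exact: open_cone_nbhs.
rewrite (_ : _ @^-1` _ = A)//; apply/seteqP; split=> mu /=; last by exists mu.
by move=> [nu Anu [<-]].
Qed.

Lemma cone_basis_inr x (U : set (W2bar X)) xi : cone_basis x U -> U (inr xi) ->
  exists r e, [/\ 0 < r, 0 < e & forall s, r <= s -> cone_nbhs x xi s e `<=` U].
Proof.
move=> [[A oA <-] [mu _]//|[xi' [r [e [r0 e0 ->]]]] /(cone_nbhs_sub hX r0)[e' e'0 h]].
by exists r, e'.
Qed.

Lemma cone_basis_join x (U V : set (W2bar X)) theta : cone_basis x U -> cone_basis x V ->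
  U theta -> V theta -> exists B, [/\ cone_basis x B, B theta & B `<=` U `&` V].
Proof.
case: theta => [mu|xi] bU bV Ut Vt.
  exists (inl @` (inl @^-1` U `&` inl @^-1` V)); split.
  - left; exists (inl @^-1` U `&` inl @^-1` V) => //.
    by apply: (@openI (W2 X)); [exact: cone_basis_inl bU|exact: cone_basis_inl bV].
  - by exists mu.
  - by move=> _ [nu ? <-].
have [r [e [r0 e0 rU]]] := cone_basis_inr bU Ut.
have [r' [e' [r'0 e'0 rV]]] := cone_basis_inr bV Vt.
have m0 : 0 < Num.min e e' by rewrite lt_min e0.
exists (cone_nbhs x xi (Num.max r r') (Num.min e e')); split.
- right; exists xi, (Num.max r r'), (Num.min e e'); split => //.
  by rewrite lt_max r0.
- exact: cone_nbhs_center.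
- move=> theta h; split.
    apply: rU (cone_nbhs_le _ h); first by rewrite le_max lexx.
    by rewrite ge_min lexx.
  apply: rV (cone_nbhs_le _ h); first by rewrite le_max lexx orbT.
  by rewrite ge_min lexx orbT.
Qed.

Lemma cone_basis_cover x theta : exists2 B, cone_basis x B & B theta.
Proof.
case: theta => [mu|xi].
  by exists (inl @` setT); [left; exists setT => //; exact: openT|exists mu].
exists (cone_nbhs x xi 1 1); last exact: cone_nbhs_center.
by right; exists xi, 1, 1; split.
Qed.

(** The topology of [cone_W2] is generated by a subbase, so its open sets are unions of finite
    intersections; these are refined here by elements of [cone_basis]. *)
Lemma cone_basis_fin x (s : seq (set (W2bar X))) theta :
  (forall U, U \in s -> cone_basis x U /\ U theta) ->
  exists B, [/\ cone_basis x B, B theta & forall U, U \in s -> B `<=` U].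
Proof.
elim: s => [_|V s IH h].
  by have [B bB Bt] := cone_basis_cover x theta; exists B.
have [|B [bB Bt Bs]] := IH.
  by move=> U Us; apply: h; rewrite inE Us orbT.
have [bV Vt] := h V (mem_head _ _).
have [C [bC Ct CBV]] := cone_basis_join bB bV Bt Vt.
exists C; split => // U; rewrite inE => /predU1P[->|/Bs BU] z /CBV[Bz Vz] //.
exact: BU.
Qed.

Lemma cone_openP x (A : set (cone_W2 x)) : open A <->
  forall theta, A theta -> exists B, [/\ cone_basis x B, B theta & B `<=` A].
Proof.
split.
  move=> [DA DAB <-] theta [V DV Vt].
  have [F FB VE] := DAB _ DV.
  have [|B [bB Bt BF]] := @cone_basis_fin x (finmap.enum_fset F) theta.
    move=> U UF; split; first by have := FB U UF; rewrite inE.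
    by have := Vt; rewrite /= -VE; apply.
  exists B; split => // z Bz; exists V => //=; rewrite -VE => U UF.
  exact: BF Bz.
move=> h; exists [set B | cone_basis x B /\ B `<=` A].
  by move=> B [bB _]; exact: (@finI_from1 _ _ (cone_basis x) id B).
apply/seteqP; split=> theta; first by move=> [B [_ BA] /BA].
by move=> /h[B [bB Bt BA]]; exists B.
Qed.

Lemma cone_basis_open x (U : set (cone_W2 x)) : cone_basis x U -> open U.
Proof. by move=> bU; apply/cone_openP => theta Ut; exists U; split. Qed.

Lemma cone_nbhsP x (theta : cone_W2 x) (A : set (cone_W2 x)) : nbhs theta A <->
  exists B, [/\ cone_basis x B, B theta & B `<=` A].
Proof.
rewrite nbhsE; split.
  move=> [V [/cone_openP oV Vt] VA]; have [B [bB Bt BV]] := oV _ Vt.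
  by exists B; split => //; exact: subset_trans VA.
by move=> [B [bB Bt BA]]; exists B => //; split => //; exact: cone_basis_open.
Qed.

Lemma cone_basisP x : basis (cone_basis x : set (set (cone_W2 x))).
Proof.
split; first by move=> U; exact: cone_basis_open.
by move=> theta A /cone_nbhsP[B [bB Bt BA]]; exists B.
Qed.

Lemma cone_basis_change x y (U : set (W2bar X)) theta : cone_basis x U -> U theta ->
  exists B, [/\ cone_basis y B, B theta & B `<=` U].
Proof.
move=> bU; case: theta => [mu|xi] Ut.
  exists (inl @` (inl @^-1` U)); split; last by move=> _ [nu ? <-].
    by left; exists (inl @^-1` U) => //; exact: cone_basis_inl bU.
  by exists mu.
have [r [e [r0 e0 rU]]] := cone_basis_inr bU Ut.
have [s [e' [s0 e'0 h]]] := cone_nbhs_change hX x y xi r0 e0.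
exists (cone_nbhs y xi s e'); split.
- by right; exists xi, s, e'.
- exact: cone_nbhs_center.
- by apply: subset_trans h _; exact: rU.
Qed.

Lemma cone_open_change x y :
  (open : set (set (cone_W2 x))) `<=` (open : set (set (cone_W2 y))).
Proof.
move=> A /cone_openP oA; apply/cone_openP => theta /oA[B [bB Bt BA]].
have [C [bC Ct CB]] := cone_basis_change y bB Bt.
by exists C; split => //; exact: subset_trans BA.
Qed.

Lemma W2_open_ball mu (r : R) : open [set nu : W2 X | W mu nu < r].
Proof.
move=> nu /= h; exists (r - W mu nu); first by rewrite subr_gt0.
move=> rho /= h'; apply: le_lt_trans (W_triangle sepX nu _ _) _.
by rewrite -ltrBrDl.
Qed.

Lemma cone_ball x mu (r : R) : cone_basis x (inl @` [set nu : W2 X | W mu nu < r]).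
Proof. by left; exists [set nu : W2 X | W mu nu < r] => //; exact: W2_open_ball. Qed.

Lemma cone_first_countable x : first_countable (cone_W2 x).
Proof.
pose k (n : nat) : R := n.+1%:R.
have k0 n : 0 < k n by rewrite ltr0n.
have small (a : R) : 0 < a -> exists n, (k n)^-1 < a.
  move=> a0; near \oo => n; exists n.
  by near: n; exact: near_infty_natSinv_lt (PosNum a0).
case=> [mu|xi].
  pose B n : set (cone_W2 x) := inl @` [set nu : W2 X | W mu nu < (k n)^-1].
  exists (range B); first exact: card_image_le.
  split.
    move=> _ [n _ <-]; apply/cone_nbhsP; exists (B n); split => //.
      exact: cone_ball.
    by exists mu => //=; rewrite Wxx// invr_gt0.
  move=> A /cone_nbhsP[U [bU Ut UA]].
  have [r r0 rU] := cone_basis_inl bU Ut.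
  have [n nr] := small r r0; exists (B n); first by exists n.
  by move=> _ [nu /= h <-]; apply: UA; apply: rU => /=; exact: lt_trans nr.
pose B n : set (cone_W2 x) := cone_nbhs x xi (k n) (k n)^-1.
exists (range B); first exact: card_image_le.
split.
  move=> _ [n _ <-]; apply/cone_nbhsP; exists (B n); split => //.
    by right; exists xi, (k n), (k n)^-1; split => //; rewrite invr_gt0.
  by apply: cone_nbhs_center; rewrite invr_gt0.
move=> A /cone_nbhsP[U [bU Ut UA]].
have [r [e [r0 e0 rU]]] := cone_basis_inr bU Ut.
(* A single [n] gives both a radius [k n] above [r] and a width [(k n)^-1] below [e]. *)
have [|n nm] := small (Num.min r^-1 e); first by rewrite lt_min e0 invr_gt0 r0.
move: nm; rewrite lt_min => /andP[nr ne].
exists (B n); first by exists n.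
apply: subset_trans UA; apply: subset_trans (rU (k n) _).
  by apply: cone_nbhs_le; exact: ltW.
by move: nr; rewrite ltf_pV2 ?posrE// => /ltW.
Unshelve. all: by end_near. Qed.

Lemma cone_separated x (U V : set (W2bar X)) (p q : cone_W2 x) :
  cone_basis x U -> cone_basis x V -> U p -> V q -> U `&` V = set0 ->
  ~ cluster (nbhs p) q.
Proof.
move=> bU bV Up Vq UV pq.
have [||z zUV] := pq U V; last by rewrite -[False]/(set0 z) -UV.
- by apply/cone_nbhsP; exists U; split.
- by apply/cone_nbhsP; exists V; split.
Qed.

(** The unit ball around [mu] lies in the closed ball around [delta x] that the cone neighbourhood
    avoids. *)
Lemma ball_cone_nbhs_disjoint x mu xi :
  inl @` [set nu : W2 X | W mu nu < 1] `&`
    cone_nbhs x xi (W (delta x) mu + 1) 1 = set0.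
Proof.
rewrite -subset0 => _ [[nu /= h <-] [/outside_inl rN _]].
have := W_triangle sepX mu (delta x) nu.
by move: h rN; gen_W; clear; lra.
Qed.

Lemma cone_hausdorff x : hausdorff_space (cone_W2 x).
Proof.
have N1 mu : 0 < W (delta x) mu + 1 by rewrite ltr_wpDl ?W_ge0.
have bN mu xi : cone_basis x (cone_nbhs x xi (W (delta x) mu + 1) 1).
  by right; exists xi, (W (delta x) mu + 1), 1; split.
have ctr mu : (inl @` [set nu : W2 X | W mu nu < 1]) (inl mu : W2bar X).
  by exists mu => //=; rewrite Wxx.
case=> [mu|xi] [nu|xi'] pq.
- congr inl; apply: contrapT => mn.
  pose r := W mu nu / 2.
  have r0 : 0 < r.
    rewrite divr_gt0// lt_neqAle W_ge0 andbT eq_sym; apply/eqP => /(W_eq0 sepX).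
    exact: mn.
  apply: (cone_separated (cone_ball x mu r) (cone_ball x nu r) _ _ _ pq).
  + by exists mu => //=; rewrite Wxx.
  + by exists nu => //=; rewrite Wxx.
  + rewrite -subset0 => _ [[m /= h <-] [n /= h' [nm]]]; subst n.
    have := W_triangle sepX m mu nu; rewrite (W_sym sepX m nu).
    by move: h h'; rewrite /r; gen_W; clear; lra.
- exfalso; apply: (cone_separated (cone_ball x mu 1) (bN mu xi') _ _ _ pq) => //.
  + exact: cone_nbhs_center.
  + exact: ball_cone_nbhs_disjoint.
- exfalso; apply: (cone_separated (bN nu xi) (cone_ball x nu 1) _ _ _ pq) => //.
  + exact: cone_nbhs_center.
  + by rewrite setIC; exact: ball_cone_nbhs_disjoint.
- congr inr; apply: contrapT => xx.
  (* Distinct classes have rays from [delta x] that differ at some time, positive since both start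
     at [delta x]. Half of the gap at this time separates the two classes. *)
  have [r [r0 rxx]] : exists r, 0 <= r /\
      geodesic_to x (inr xi) r <> geodesic_to x (inr xi') r.
    apply: contrapT => h; apply: xx; apply: (boundary_eq hX (x := x)) => r r0.
    by apply: contrapT => h'; apply: h; exists r.
  have r_gt0 : 0 < r.
    rewrite lt_neqAle r0 andbT eq_sym; apply/eqP => r00; apply: rxx; rewrite r00.
    have [_ -> _] := geodesic_to_inr hX x xi.
    by have [_ -> _] := geodesic_to_inr hX x xi'.
  pose e := W (geodesic_to x (inr xi) r) (geodesic_to x (inr xi') r) / 2.
  have e0 : 0 < e.
    rewrite divr_gt0// lt_neqAle W_ge0 andbT eq_sym; apply/eqP => /(W_eq0 sepX).
    exact: rxx.
  apply: (cone_separated (U := cone_nbhs x xi r e) (V := cone_nbhs x xi' r e) _ _ _ _ _ pq).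
  + by right; exists xi, r, e.
  + by right; exists xi', r, e.
  + exact: cone_nbhs_center.
  + exact: cone_nbhs_center.
  + rewrite -subset0 => theta [[_ h] [_ h']].
    have := W_triangle sepX (geodesic_to x theta r) (geodesic_to x (inr xi) r)
      (geodesic_to x (inr xi') r).
    rewrite (W_sym sepX (geodesic_to x (inr xi) r) (geodesic_to x theta r)).
    by move: h h'; rewrite /e; gen_W; clear; lra.
Qed.

Lemma cone_induced x :
  (open : set (set (initial_topology (inl : W2 X -> cone_W2 x)))) =
  (open : set (set (W2 X))).
Proof.
apply/seteqP; split=> A.
  move=> [B /cone_openP oB <-]; suff : W2_open (inl @^-1` B) by [].
  move=> mu /= /oB[U [bU Ut UB]].
  have [r r0 rU] := cone_basis_inl bU Ut.
  by exists r => // nu /rU /UB.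
move=> oA; exists (inl @` A); first by apply: cone_basis_open; left; exists A.
by apply/seteqP; split=> mu /=; [move=> [nu Anu [<-]]|exists mu].
Qed.

End Topology.

Theorem proposition6p1 (R : realType) (X : completePMetricType R)
    (hX : hadamard X) (x : X) :
  [/\ basis (cone_basis x : set (set (cone_W2 x))),
      forall y : X, (open : set (set (cone_W2 x))) = (open : set (set (cone_W2 y))),
      first_countable (cone_W2 x),
      hausdorff_space (cone_W2 x) &
      (open : set (set (initial_topology (inl : W2 X -> cone_W2 x))))
      = (open : set (set (W2 X))) ].
Proof.
split.
- exact: cone_basisP.
- move=> y; apply/seteqP; split.
    exact: (@cone_open_change _ _ hX x y).
  exact: (@cone_open_change _ _ hX y x).
- exact: cone_first_countable.
- exact: cone_hausdorff.
- exact: cone_induced.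
Qed.
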